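(* Let $\mathcal{A}$ be an o-minimal structure on the real field $(\mathbb{R},+,\cdot)$. Let $X\subset\mathbb{R}^{n}$ be a definable set with $\dim(X)\leq n-1$, and let $p\in\mathbb{N}^{\ast}$. Then there are $\varepsilon>0$ and a finite set $\{v_{1},\dots,v_{k}\}\subset\mathbb{R}^{n-1}$ such that for every $x\in\mathbb{R}^{n}$ there is $i\in\{1,\dots,k\}$ such that the projection $\pi_{v_{i}}$ is $(\varepsilon,p)$-weak regular at $x$ with respect to $X$.
   Context: ''Definable'' means definable in the fixed o-minimal structure $\mathcal{A}$. $\mathbb{N}^{\ast}$ is the set of positive integers. For $\lambda\in\mathbb{R}^{n-1}$, $\pi_{\lambda}:\mathbb{R}^{n}\to\mathbb{R}^{n-1}$ is the linear projection parallel to the vector $(\lambda,1)\in\mathbb{R}^{n}$. $B(v,r)$ is the open ball of center $v$ and radius $r$. For $x\in\mathbb{R}^{n}$, $v\in\mathbb{R}^{n-1}$, $\varepsilon>0$, put $$C_{\varepsilon}(x,v)=\{x+t(v',1) : t\in\mathbb{R}\setminus\{0\},\ v'\in B(v,\varepsilon)\}.$$ Let $\varepsilon>0$, $p\in\mathbb{N}^{\ast}$ and let $X\subset\mathbb{R}^n$ be definable. The projection $\pi_{\lambda}$ is called $(\varepsilon,p)$-weak regular at $x\in\mathbb{R}^{n}$ with respect to $X$ if: (1) the restriction $(\pi_{\lambda})_{|X}$ is finite (i.e. has finite fibres); (2) the set $X\cap C_{\varepsilon}(x,\lambda)$ is either empty or a finite disjoint union of sets of the form $A_{f_{i}}=\{x+f_{i}(\lambda')(\lambda',1)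 : \lambda'\in B(\lambda,\varepsilon)\}$, where the $f_{i}$ are non-vanishing real-valued $C^{p}$ functions defined on $B(\lambda,\varepsilon)$. *)

(* Defs.v *)
From mathcomp Require Import all_boot all_order all_algebra.
From mathcomp Require Import all_classical all_reals all_analysis.

Set Implicit Arguments.
Unset Strict Implicit.
Unset Printing Implicit Defensive.

Import Order.TTheory GRing.Theory Num.Theory.
Import numFieldNormedType.Exports.

Local Open Scope classical_set_scope.
Local Open Scope ring_scope.

(* A point of R^(n+1) is split as (butlast x, vlast x) in R^n x R;
   vpair v t is the point (v, t). *)
Definition butlast (R : realType) (n : nat) (x : 'rV[R]_n.+1) : 'rV[R]_n :=
  col' ord_max x.

Definition vlast (R : realType) (n : nat) (x : 'rV[R]_n.+1) : R :=
  x ord0 ord_max.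

Definition vpair (R : realType) (n : nat) (v : 'rV[R]_n) (t : R) :
    'rV[R]_n.+1 :=
  \row_(j < n.+1) if unlift ord_max j is Some i then v ord0 i else t.

(* S n is the collection of definable subsets of R^n.  An interval R is an
   interval of any kind: bounded or not, possibly a singleton or empty.  The
   order of R need not be mentioned, being definable from + and *.  As S 1
   contains the singletons, definability is with parameters. *)
Record o_minimal_structure (R : realType)
    (S : forall n : nat, set (set 'rV[R]_n)) : Prop := {
  omin_set0 : forall n : nat, S n set0;
  omin_setU : forall (n : nat) (A B : set 'rV[R]_n),
    S n A -> S n B -> S n (A `|` B);
  omin_setC : forall (n : nat) (A : set 'rV[R]_n), S n A -> S n (~` A);
  omin_diag : forall (n : nat) (i j : 'I_n),
    S n [set x | x ord0 i = x ord0 j];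
  omin_prodr : forall (n : nat) (A : set 'rV[R]_n),
    S n A -> S n.+1 [set x | A (col' ord_max x)];
  omin_prodl : forall (n : nat) (A : set 'rV[R]_n),
    S n A -> S n.+1 [set x | A (col' ord0 x)];
  omin_proj : forall (n : nat) (A : set 'rV[R]_n.+1),
    S n.+1 A -> S n (@butlast R n @` A);
  omin_add : S 3 [set x | x ord0 (inord 2) = x ord0 (inord 0) + x ord0 (inord 1)];
  omin_mul : S 3 [set x | x ord0 (inord 2) = x ord0 (inord 0) * x ord0 (inord 1)];
  omin_line : forall A : set 'rV[R]_1,
    S 1 A <-> exists s : seq (interval R),
      A = [set x | exists2 I : interval R, I \in s & x ord0 ord0 \in I]
}.

Definition graph_on (R : realType) (n : nat) (A : set 'rV[R]_n)
    (f : 'rV[R]_n -> R) : set 'rV[R]_n.+1 :=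
  [set x | A (butlast x) /\ vlast x = f (butlast x)].

Definition band_on (R : realType) (n : nat) (A : set 'rV[R]_n)
    (f g : 'rV[R]_n -> \bar R) : set 'rV[R]_n.+1 :=
  [set x | A (butlast x) /\
    (f (butlast x) < (vlast x)%:E < g (butlast x))%E].

Definition definable_continuous (R : realType)
    (S : forall n : nat, set (set 'rV[R]_n)) (n : nat) (A : set 'rV[R]_n)
    (f : 'rV[R]_n -> R) : Prop :=
  S n.+1 (graph_on A f) /\ {within A, continuous f}.

Definition cell_bound (R : realType)
    (S : forall n : nat, set (set 'rV[R]_n)) (n : nat) (A : set 'rV[R]_n)
    (f : 'rV[R]_n -> \bar R) : Prop :=
  [\/ f = (fun=> -oo%E), f = (fun=> +oo%E)
    | exists2 g : 'rV[R]_n -> R,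
        definable_continuous S A g & f = (fun x => (g x)%:E)].

(* is_cell S n d C: C is an (i_1, ..., i_n)-cell with i_1 + ... + i_n = d.
   The induction starts from the point R^0, so that the cells of R^1 are the
   points and the nonempty open intervals. *)
Inductive is_cell (R : realType) (S : forall n : nat, set (set 'rV[R]_n)) :
    forall n : nat, nat -> set 'rV[R]_n -> Prop :=
| is_cell_point : is_cell S 0%N (setT : set 'rV[R]_0)
| is_cell_graph (n d : nat) (B : set 'rV[R]_n) (f : 'rV[R]_n -> R) :
    is_cell S d B -> definable_continuous S B f ->
    is_cell S d (graph_on B f)
| is_cell_band (n d : nat) (B : set 'rV[R]_n) (f g : 'rV[R]_n -> \bar R) :
    is_cell S d B -> cell_bound S B f -> cell_bound S B g ->
    (forall x, B x -> (f x < g x)%E) ->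
    is_cell S d.+1 (band_on B f g).

(* The largest dimension of a cell contained in X; -oo if X is empty. *)
Definition omin_dim (R : realType) (S : forall n : nat, set (set 'rV[R]_n))
    (n : nat) (X : set 'rV[R]_n) : \bar R :=
  ereal_sup [set (d%:R)%:E | d in
    [set d : nat | exists2 C : set 'rV[R]_n, is_cell S d C & C `<=` X]].

(* MathComp-Analysis equips 'rV[R]_n with the sup norm, hence this
   Euclidean version of the open ball. *)
Definition eball (R : realType) (n : nat) (v : 'rV[R]_n) (r : R) :
    set 'rV[R]_n :=
  [set w | Num.sqrt (\sum_(i < n) (w ord0 i - v ord0 i) ^+ 2) < r].

(* All iterated partial derivatives of f of order at most p exist and are
   continuous at every point of U.  Meant for U open: the values of f outside
   U are then irrelevant. *)
Fixpoint is_Cp (R : realType) (n p : nat) (U : set 'rV[R]_n)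
    (f : 'rV[R]_n -> R) : Prop :=
  (forall x, U x -> {for x, continuous f}) /\
  if p is q.+1 then
    forall i : 'I_n,
      (forall x, U x -> derivable f x (delta_mx ord0 i)) /\
      is_Cp q U (fun x => 'D_(delta_mx ord0 i) f x)
  else True.

(* The projection of R^(n+1) onto R^n x {0} parallel to (lambda, 1). *)
Definition proj_along (R : realType) (n : nat) (lambda : 'rV[R]_n)
    (x : 'rV[R]_n.+1) : 'rV[R]_n :=
  butlast x - vlast x *: lambda.

Definition cone (R : realType) (n : nat) (eps : R) (x : 'rV[R]_n.+1)
    (v : 'rV[R]_n) : set 'rV[R]_n.+1 :=
  [set x + t *: vpair v' 1 | t in [set t : R | t != 0] & v' in eball v eps].

Definition sheet (R : realType) (n : nat) (eps : R) (x : 'rV[R]_n.+1)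
    (lambda : 'rV[R]_n) (f : 'rV[R]_n -> R) : set 'rV[R]_n.+1 :=
  [set x + f l *: vpair l 1 | l in eball lambda eps].

Definition weak_regular (R : realType) (n : nat) (eps : R) (p : nat)
    (lambda : 'rV[R]_n) (x : 'rV[R]_n.+1) (X : set 'rV[R]_n.+1) : Prop :=
  (forall u : 'rV[R]_n, finite_set (X `&` proj_along lambda @^-1` [set u])) /\
  (X `&` cone eps x lambda = set0 \/
   exists (k : nat) (f : 'I_k -> 'rV[R]_n -> R),
     [/\ forall i, is_Cp p (eball lambda eps) (f i),
         forall i l, eball lambda eps l -> f i l != 0,
         trivIset setT (fun i => sheet eps x lambda (f i))
       & X `&` cone eps x lambda = \bigcup_i sheet eps x lambda (f i)]).

(* Main.v *)
(* Let C_x be the set of pairs (v, t) with t <> 0 and x + t (v, 1) in X, so that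
   the sheets at x are graphs contained in C_x.

   (a) Uniform subboxes.  For a definable family A_u of subsets of R^m and a
   box B there are finitely many subboxes of B such that every A_u contains or
   misses one of them.  For m = 1 this follows from a uniform bound on the
   number of boundary points of the A_u, and the general case by induction on m,
   slicing by the last coordinate.  Finitely many families can be treated at
   once.

   (b) Definable Baire property.  If countably many definable sets cover a box,
   one of them contains a box; on the line, a definable set without interior is
   finite, hence it is enough that intervals are uncountable.  Taking rational
   parameters, this gives short proofs that definable functions are generically
   C^p, and of uniform finiteness in one-parameter families.

   (c) Good directions.  The v such that every line of direction (v, 1) meets X
   in a finite set contain a box inside every box.  Otherwise (b) yields C^1
   functions u on a box and an interval of t with (u v + t v, t) in X.  Since
   v |-> u v + t v has invertible derivative at a given point for all but
   finitely many t, its image contains a box, and X would have interior.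

   On a box of good directions the fibres of C_x have at most N points, by
   uniform finiteness, and the j-th point f_j (x, v) of the fibre is a definable
   function of (x, v).  By (a), applied to the sets where f_j exists and where
   f_j (x, .) is C^p, finitely many boxes are enough; generic regularity excludes
   that f_j (x, .) is C^p nowhere on one of them. *)
From HB Require Import structures.
Require Import Defs.
From mathcomp Require Import all_boot all_order all_algebra.
From mathcomp Require Import all_classical all_reals all_analysis.
From mathcomp Require Import zify ring lra.

Set Implicit Arguments.
Unset Strict Implicit.
Unset Printing Implicit Defensive.

Import Order.TTheory GRing.Theory Num.Theory.
Import numFieldNormedType.Exports.

Local Open Scope classical_set_scope.
Local Open Scope ring_scope.

(** * Definability in first-order terms *)

(* A type whose elements are coded by their first [ddim] coordinates, read off
   an infinite stream of reals. *)
Class Dtype (R : realType) (T : Type) := {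
  ddim : nat;
  dec : (nat -> R) -> T;
  enc : T -> nat -> R;
  decK : forall t, dec (enc t) = t;
  encK : forall e i, (i < ddim)%N -> enc (dec e) i = e i;
  dec_ext : forall e e', (forall i, (i < ddim)%N -> e i = e' i) -> dec e = dec e'
}.
Arguments ddim {R} T {_}.
Arguments enc : simpl never.
Arguments dec {R T _} e.
Arguments enc {R T _} t i.

Section Dtypes.
Context {R : realType}.

Definition real_Dtype : Dtype R R.
Proof.
refine {| ddim := 1; dec e := e 0%N; enc t := fun=> t |} => //.
  by move=> e [].
by move=> e e'; apply.
Defined.

(** The zero tail makes the stream a function of the row alone; the same tail reappears in
    [defN_proj] and [defN_sub]. *)
Definition stream n (x : 'rV[R]_n) (i : nat) : R :=
  if insub i is Some j then x ord0 j else 0.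

Lemma stream_ord n (x : 'rV[R]_n) (i : 'I_n) : stream x i = x ord0 i.
Proof. by rewrite /stream insubT //= => p; congr (x _ _); apply/val_inj. Qed.

Lemma stream_out n (x : 'rV[R]_n) i : (n <= i)%N -> stream x i = 0.
Proof. by move=> h; rewrite /stream insubF // ltnNge h. Qed.

Definition row_Dtype n : Dtype R 'rV[R]_n.
Proof.
refine {| ddim := n; dec e := \row_i e i;
     enc x := stream x |}.
- by move=> t; apply/rowP => i; rewrite mxE stream_ord.
- by move=> e i h; rewrite (stream_ord _ (Ordinal h)) mxE.
- by move=> e e' h; apply/rowP => i; rewrite !mxE h.
Defined.

Definition unit_Dtype : Dtype R unit.
Proof. by refine {| ddim := 0; dec e := tt; enc x := fun => 0 |} => //; case. Defined.

Definition prod_Dtype T U (dT : Dtype R T) (dU : Dtype R U) : Dtype R (T * U).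
Proof.
refine {| ddim := ddim T + ddim U;
     dec e := (dec e, dec (fun i => e (ddim T + i)%N));
     enc x := fun i =>
       if (i < ddim T)%N then enc x.1 i else enc x.2 (i - ddim T)%N |}.
- case=> t u; congr pair; rewrite -[RHS]decK; apply: dec_ext => i hi.
    by rewrite hi.
  by rewrite ltnNge leq_addr /= addKn.
- move=> e i H; case: ifPn => hi; first by rewrite encK.
  by rewrite encK; [congr e; lia|lia].
- by move=> e e' H; congr pair; apply: dec_ext => i hi; apply: H; lia.
Defined.
End Dtypes.

#[export] Existing Instance real_Dtype.
#[export] Existing Instance row_Dtype.
#[export] Existing Instance unit_Dtype.
#[export] Existing Instance prod_Dtype.

Section Definability.
Context {R : realType} {S : forall n : nat, set (set 'rV[R]_n)}.
Hypothesis hS : o_minimal_structure S.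

(** Variables are positions in a stream rather than ordinals below [n], so that shifting, permuting
    or merging them needs no cast between row types. *)
Definition defN n (P : (nat -> R) -> Prop) : Prop :=
  S [set x : 'rV[R]_n | P (stream x)].

Lemma defN_ext n P Q : (forall x : 'rV[R]_n, P (stream x) <-> Q (stream x)) ->
  defN n P -> defN n Q.
Proof.
by rewrite /defN => H; congr (S _); apply/predeqP => x; split=> /H.
Qed.

Lemma defN_not n P : defN n P -> defN n (fun e => ~ P e).
Proof. exact: omin_setC. Qed.

Lemma defN_or n P Q : defN n P -> defN n Q -> defN n (fun e => P e \/ Q e).
Proof. exact: omin_setU. Qed.

Lemma defN_and n P Q : defN n P -> defN n Q -> defN n (fun e => P e /\ Q e).
Proof.
move=> /defN_not hP /defN_not hQ.
apply: defN_ext (defN_not (defN_or hP hQ)) => x; split; last by tauto.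
by move=> /not_orP[/contrapT ? /contrapT].
Qed.

Lemma defN_const n (Q : Prop) : defN n (fun=> Q).
Proof.
have h0 : defN n (fun=> False) by exact: (omin_set0 hS).
have [q|q] := pselect Q; last by apply: defN_ext h0 => x; split.
by apply: defN_ext (defN_not h0) => x; split => // _ [].
Qed.

Lemma defN_forall n k (P : nat -> (nat -> R) -> Prop) :
  (forall i, (i < k)%N -> defN n (P i)) ->
  defN n (fun e => forall i, (i < k)%N -> P i e).
Proof.
elim: k => [|k IH] h; first by apply: defN_ext (defN_const _ True).
have hk := IH (fun i hi => h i (ltnW hi)).
apply: defN_ext (defN_and hk (h k (ltnSn k))) => x; split.
  by case=> H1 H2 i; rewrite ltnS leq_eqVlt => /predU1P[->|/H1].
by move=> H; split => [i hi|]; apply: H; lia.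
Qed.

Lemma defN_eq n i j : (i < n)%N -> (j < n)%N -> defN n (fun e => e i = e j).
Proof.
move=> hi hj; have := omin_diag hS (Ordinal hi) (Ordinal hj).
rewrite /defN; congr (S _); apply/predeqP => x.
by rewrite /= -!stream_ord.
Qed.

Lemma defN_prodl m n P :
  defN n P -> defN (m + n) (fun e => P (fun i => e (m + i)%N)).
Proof.
move=> h; elim: m => // m /(omin_prodl hS); rewrite /defN addSn.
congr (S _); apply/predeqP => x /=.
suff -> : (fun i => stream (col' ord0 x) (m + i)%N) =
          (fun i => stream x (m + i).+1) by [].
apply/funext => i; have [h1|h1] := ltnP (m + i)%N (m + n)%N; last first.
  by rewrite !stream_out.
have h2 : ((m + i).+1 < (m + n).+1)%N by lia.
rewrite (stream_ord _ (Ordinal h1)) (stream_ord x (Ordinal h2)) mxE.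
by congr (x _ _); apply/val_inj.
Qed.

(** The last coordinates are projected away one at a time by [omin_proj]. The witness [y] is a whole
    stream, of which only the entries from [m] to [m + n - 1] are read. *)
Lemma defN_proj m n Q : defN (m + n) Q -> defN m (fun e => exists y : nat -> R,
  Q (fun i => if (i < m)%N then e i else if (i < m + n)%N then y i else 0)).
Proof.
elim: n Q => [|n IH] Q.
  rewrite addn0; apply: defN_ext => x.
  have -> : stream x = (fun i => if (i < m)%N then stream x i else 0).
    by apply/funext => i; case: ltnP => // h; rewrite stream_out.
  split=> [h|[y]]; last first.
    by congr Q; apply/funext => i; case: ifP => // ->.
  by exists (fun=> 0); move: h; congr Q; apply/funext => i; case: ifP => // ->.
rewrite addnS => hQ.
have {hQ} h : defN (m + n) (fun e => exists t,
    Q (fun i => if i == (m + n)%N then t else e i)).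
  have := omin_proj hS hQ; congr (S _); apply/predeqP => x /=; split.
    case=> z hz <-; exists (z ord0 ord_max); move: hz; congr Q.
    apply/funext => i; case: eqP => [->|hi].
      by rewrite (stream_ord z ord_max).
    have [h1|h1] := ltnP i (m + n)%N; last by rewrite !stream_out //; lia.
    have h2 : (i < (m + n).+1)%N by lia.
    rewrite (stream_ord _ (Ordinal h1)) (stream_ord z (Ordinal h2)) mxE.
    by congr (z _ _); apply/val_inj; rewrite /= /bump; lia.
  case=> t ht; exists (\row_i if (i : nat) == (m + n)%N then t else stream x i).
    move: ht; congr Q; apply/funext => i.
    have [h1|h1] := ltnP i (m + n).+1; last first.
      by rewrite !stream_out //; [case: eqP => //; lia|lia].
    by rewrite (stream_ord (\row_i _) (Ordinal h1)) mxE.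
  apply/rowP => i; rewrite !mxE /= /bump.
  have -> : (m + n <= i)%N = false by have := ltn_ord i; lia.
  by rewrite /= -(stream_ord x i) add0n; case: eqP => // ?; have := ltn_ord i; lia.
apply: defN_ext (IH _ h) => x; split=> [[y [t]]|[y]].
  move=> hq; exists (fun i => if i == (m + n)%N then t else y i).
  move: hq; congr Q; apply/funext => i.
  by repeat case: ifPn; move=> *; (reflexivity || lia).
move=> hq; exists y, (y (m + n)%N).
move: hq; congr Q; apply/funext => i.
repeat case: ifPn; move=> *; try (reflexivity || lia).
by congr y; lia.
Qed.

(** The axioms provide cylinders, diagonals and projections. A substitution of variables is
    therefore written as the existence of [n] new coordinates that satisfy [P] and equal the
    prescribed old ones. *)
Lemma defN_sub m n P (f : nat -> nat) :
  (forall i, (i < n)%N -> (f i < m)%N) -> defN n P ->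
  defN m (fun e => P (fun i => if (i < n)%N then e (f i) else 0)).
Proof.
move=> hf /(defN_prodl m) h1.
have h2 : defN (m + n) (fun e => forall i, (i < n)%N -> e (m + i)%N = e (f i)).
  by apply: defN_forall => i hi; apply: defN_eq; have := hf i hi; lia.
apply: defN_ext (defN_proj (defN_and h1 h2)) => x; split.
  case=> y [hq hy]; move: hq; congr P; apply/funext => i.
  case: (ltnP i n) => hi; last by repeat case: ifPn => ?; (reflexivity || lia).
  have := hy i hi; have -> : (m + i < m)%N = false by lia.
  by rewrite (hf i hi).
move=> hq; exists (fun i => stream x (f (i - m)%N)); split.
  move: hq; congr P; apply/funext => i; rewrite addKn.
  by repeat case: ifPn; move=> *; (reflexivity || lia).
move=> i hi; rewrite addKn (hf i hi).
by repeat case: ifPn; move=> *; (reflexivity || lia).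
Qed.

Definition definable T `{Dtype R T} (P : T -> Prop) : Prop :=
  defN (ddim T) (fun e => P (dec e)).

Definition definable_fun T U `{Dtype R T} `{Dtype R U} (f : T -> U) : Prop :=
  definable (fun p : T * U => p.2 = f p.1).

Section Connectives.
Context {T U : Type} `{dT : Dtype R T} `{dU : Dtype R U}.

Lemma definable_ext (P Q : T -> Prop) : (forall t, P t <-> Q t) -> definable P -> definable Q.
Proof. by move=> h; apply: defN_ext. Qed.

Lemma definable_sub (h : U -> T) (f : nat -> nat) (P : T -> Prop) :
  (forall i, (i < ddim T)%N -> (f i < ddim U)%N) ->
  (forall e, h (dec e) = dec (fun i => e (f i))) ->
  definable P -> definable (fun u => P (h u)).
Proof.
move=> hf hh /(defN_sub hf); apply: defN_ext => x; rewrite hh.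
by split; congr P; apply: dec_ext => i ->.
Qed.

Lemma definable_not (P : T -> Prop) : definable P -> definable (fun t => ~ P t).
Proof. exact: defN_not. Qed.

Lemma definable_and (P Q : T -> Prop) : definable P -> definable Q -> definable (fun t => P t /\ Q t).
Proof. exact: defN_and. Qed.

Lemma definable_or (P Q : T -> Prop) : definable P -> definable Q -> definable (fun t => P t \/ Q t).
Proof. exact: defN_or. Qed.

Lemma definable_const (Q : Prop) : definable (fun _ : T => Q).
Proof. exact: defN_const. Qed.

Lemma definable_imp (P Q : T -> Prop) : definable P -> definable Q -> definable (fun t => P t -> Q t).
Proof.
move=> hP hQ; apply: definable_ext (definable_or (definable_not hP) hQ) => t; split; first by tauto.
by move=> h; have [/h|] := pselect (P t); [right|left].
Qed.

Lemma definable_iff (P Q : T -> Prop) : definable P -> definable Q -> definable (fun t => P t <-> Q t).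
Proof. by move=> hP hQ; apply: definable_and; apply: definable_imp. Qed.

Lemma definable_ex (P : T -> U -> Prop) : definable (fun p : T * U => P p.1 p.2) ->
  definable (fun t => exists u, P t u).
Proof.
move=> /defN_proj; apply: defN_ext => x; split.
  case=> y /=; set e := (fun i => if (i < ddim T)%N then _ else _).
  rewrite (_ : dec e = dec (stream x)); first by eexists; eassumption.
  by apply: dec_ext => i; rewrite /e => ->.
case=> u hu; exists (fun i => enc u (i - ddim T)%N) => /=.
set e := (fun i => if (i < ddim T)%N then _ else _).
rewrite (_ : dec e = dec (stream x)); last first.
  by apply: dec_ext => i; rewrite /e => ->.
rewrite (_ : dec _ = u) //.
rewrite -[RHS]decK; apply: dec_ext => i hi; rewrite /e addKn.
by rewrite ltn_add2l hi ltnNge leq_addr.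
Qed.
End Connectives.

Section Quantifiers.
Context {T U : Type} `{dT : Dtype R T} `{dU : Dtype R U}.

Lemma definable_all (P : T -> U -> Prop) : definable (fun p : T * U => P p.1 p.2) ->
  definable (fun t => forall u, P t u).
Proof.
move=> /definable_not h.
apply: definable_ext (definable_not (definable_ex (P := fun t u => ~ P t u) h)) => t; split.
  by move=> h1 u; apply: contrapT => h2; apply: h1; exists u.
by move=> h1 [u].
Qed.

Lemma definable_ex2 (P Q : T -> U -> Prop) :
  definable (fun p : T * U => P p.1 p.2 /\ Q p.1 p.2) ->
  definable (fun t => exists2 u, P t u & Q t u).
Proof.
move=> h; have := definable_ex (P := fun t u => P t u /\ Q t u) h.
by apply: definable_ext => t; split=> [[u []]|[u]]; exists u.
Qed.

Lemma definable_eq : definable (fun p : T * T => p.1 = p.2).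
Proof.
have h : defN (ddim T + ddim T)
    (fun e => forall i, (i < ddim T)%N -> e i = e (ddim T + i)%N).
  by apply: defN_forall => i hi; apply: defN_eq; lia.
apply: defN_ext h => x /=; split=> [h|]; first exact: dec_ext.
set e := (fun i => stream x (ddim T + i)) => h i hi.
by rewrite -(encK (T := T) (stream x)) // h encK.
Qed.

Lemma definable_finall (I : finType) (P : I -> T -> Prop) :
  (forall i, definable (P i)) -> definable (fun t => forall i, P i t).
Proof.
move=> h.
have {}h : definable (fun t => forall k, (k < #|I|)%N ->
    forall i, enum_rank i = k :> nat -> P i t).
  apply: defN_forall => k hk; apply: defN_ext (h (enum_val (Ordinal hk))) => x.
  split=> [h1 i hi|h1]; last by apply: h1; rewrite enum_valK.
  rewrite (_ : i = enum_val (Ordinal hk)) //.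
  by apply: enum_rank_inj; rewrite enum_valK; apply/val_inj.
apply: definable_ext h => t; split=> [h i|h k hk i _]; last exact: h.
exact: (h (enum_rank i)).
Qed.

Lemma definable_finex (I : finType) (P : I -> T -> Prop) :
  (forall i, definable (P i)) -> definable (fun t => exists i, P i t).
Proof.
move=> h; have := definable_not (definable_finall (fun i => definable_not (h i))).
apply: definable_ext => t; split; last by case=> i hi /(_ i).
by move=> h1; apply: contrapT => h2; apply: h1 => i hi; apply: h2; exists i.
Qed.

End Quantifiers.

Section Composition.
Context {T U V : Type} `{dT : Dtype R T} `{dU : Dtype R U} `{dV : Dtype R V}.

Lemma definable_snd (P : U -> Prop) : definable P -> definable (fun p : T * U => P p.2).
Proof. by apply: (definable_sub (f := addn (ddim T))) => //= i h; lia. Qed.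

(** [P (f t)] is read as the existence of a value [u] of [f] at [t] with [P u]. *)
Lemma definable_comp (P : U -> Prop) (f : T -> U) :
  definable_fun f -> definable P -> definable (fun t => P (f t)).
Proof.
move=> hf hP; have h2 := definable_snd hP.
apply: definable_ext (definable_ex (P := fun t u => u = f t /\ P u) (definable_and hf h2)) => t.
by split=> [[u [->]]|h] //; exists (f t).
Qed.
End Composition.

Section CoordinateSelection.
Context {T U V : Type} `{dT : Dtype R T} `{dU : Dtype R U} `{dV : Dtype R V}.

Lemma definable_fun_sub (h : U -> T) (f : nat -> nat) :
  (forall i, (i < ddim T)%N -> (f i < ddim U)%N) ->
  (forall e, h (dec e) = dec (fun i => e (f i))) -> definable_fun h.
Proof.
move=> hf hh.
apply: (definable_sub (h := fun p : U * T => (p.2, h p.1))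
  (f := fun i => if (i < ddim T)%N then (ddim U + i)%N else f (i - ddim T)%N)
  (P := fun p : T * T => p.1 = p.2)).
- move=> i /= hi; case: ifPn => h1; first by lia.
  by rewrite ltn_addr // hf //; lia.
- move=> e /=; congr pair; first by apply: dec_ext => i ->.
  rewrite hh; apply: dec_ext => i hi.
  by rewrite ltnNge leq_addr /= addKn.
- exact: definable_eq.
Qed.

Lemma definable_fun_ext (f g : T -> U) : f =1 g -> definable_fun f -> definable_fun g.
Proof. by move=> h; apply: definable_ext => -[t u] /=; rewrite h. Qed.

End CoordinateSelection.

Section Projections.
Context {T U V : Type} `{dT : Dtype R T} `{dU : Dtype R U} `{dV : Dtype R V}.

Lemma definable_fun_id : definable_fun (fun t : T => t).
Proof. exact: (definable_fun_sub (f := id)). Qed.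

Lemma definable_fun_proj1 : definable_fun (fun p : T * U => p.1).
Proof. by apply: (definable_fun_sub (f := id)) => //= i h; lia. Qed.

Lemma definable_fun_proj2 : definable_fun (fun p : T * U => p.2).
Proof. by apply: (definable_fun_sub (f := addn (ddim T))) => //= i h; lia. Qed.

End Projections.

Section FunctionComposition.
Context {T U V : Type} `{dT : Dtype R T} `{dU : Dtype R U} `{dV : Dtype R V}.

Lemma definable_fun_comp (g : U -> V) (f : T -> U) :
  definable_fun g -> definable_fun f -> definable_fun (fun t => g (f t)).
Proof.
move=> hg hf.
have h1 : definable (fun p : (T * V) * U => p.2 = f p.1.1).
  apply: (definable_sub (P := fun p : T * U => p.2 = f p.1)
    (h := fun p : (T * V) * U => (p.1.1, p.2)) (f := fun i =>
    if (i < ddim T)%N then i else (i + ddim V)%N)) hf.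
    by move=> i /= ?; case: ifP => ?; lia.
  move=> e /=; congr pair; apply: dec_ext => i hi; first by rewrite hi.
  by rewrite ltnNge leq_addr /=; congr e; lia.
have h2 : definable (fun p : (T * V) * U => p.1.2 = g p.2).
  apply: (definable_sub (P := fun p : U * V => p.2 = g p.1)
    (h := fun p : (T * V) * U => (p.2, p.1.2)) (f := fun i =>
    if (i < ddim U)%N then (ddim T + ddim V + i)%N else
      (ddim T + (i - ddim U))%N)) hg.
    by move=> i /= ?; case: ifPn => ?; lia.
  move=> e /=; congr pair; apply: dec_ext => i hi; first by rewrite hi.
  by rewrite ltnNge leq_addr /=; congr e; lia.
apply: definable_ext (definable_ex (P := fun (p : T * V) u => u = f p.1 /\ p.2 = g u)
  (definable_and h1 h2)) => -[t v] /=.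
by split=> [[u [->]]|->] //; exists (f t).
Qed.
End FunctionComposition.

Section Pairing.
Context {T U V : Type} `{dT : Dtype R T} `{dU : Dtype R U} `{dV : Dtype R V}.

Lemma definable_fun_fst (f : T -> U * V) : definable_fun f -> definable_fun (fun t => (f t).1).
Proof. by apply: (definable_fun_comp (g := fun p : U * V => p.1)); apply: definable_fun_proj1. Qed.

Lemma definable_fun_snd (f : T -> U * V) : definable_fun f -> definable_fun (fun t => (f t).2).
Proof. by apply: (definable_fun_comp (g := fun p : U * V => p.2)); apply: definable_fun_proj2. Qed.

Lemma definable_fun_pair (f : T -> U) (g : T -> V) :
  definable_fun f -> definable_fun g -> definable_fun (fun t => (f t, g t)).
Proof.
move=> hf hg.
have h1 : definable (fun p : T * (U * V) => p.2.1 = f p.1).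
  apply: (definable_sub (P := fun p : T * U => p.2 = f p.1)
    (h := fun p : T * (U * V) => (p.1, p.2.1)) (f := id)) hf.
    by move=> i /= ?; lia.
  by move=> e.
have h2 : definable (fun p : T * (U * V) => p.2.2 = g p.1).
  apply: (definable_sub (P := fun p : T * V => p.2 = g p.1)
    (h := fun p : T * (U * V) => (p.1, p.2.2)) (f := fun i =>
    if (i < ddim T)%N then i else (i + ddim U)%N)) hg.
    by move=> i /= ?; case: ifP => ?; lia.
  move=> e /=; congr pair; apply: dec_ext => i hi; first by rewrite hi.
  by rewrite ltnNge leq_addr /=; congr e; lia.
apply: definable_ext (definable_and h1 h2) => -[t [u v]] /=.
by split=> [[-> ->]|[-> ->]].
Qed.

End Pairing.

Section Equality.
Context {T U : Type} `{dT : Dtype R T} `{dU : Dtype R U}.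

Lemma definable_eqf (f g : T -> U) : definable_fun f -> definable_fun g -> definable (fun t => f t = g t).
Proof.
move=> hf hg.
exact: (definable_comp (P := fun p : U * U => p.1 = p.2) (definable_fun_pair hf hg) definable_eq).
Qed.
End Equality.

Section Intervals.
Context {T : Type} `{dT : Dtype R T}.

Lemma definable_row n (A : set 'rV[R]_n) : S A <-> definable (fun x : 'rV[R]_n => A x).
Proof.
rewrite /definable /defN /=; split; congr (S _); apply/predeqP => x /=;
by rewrite (_ : \row_i stream x i = x) //; apply/rowP => i;
   rewrite mxE stream_ord.
Qed.

Lemma definable_itv (s : seq (interval R)) :
  definable (fun x : R => exists2 I : interval R, I \in s & x \in I).
Proof.
have : S [set x : 'rV[R]_1 | exists2 I : interval R,
    I \in s & x ord0 ord0 \in I] by apply/(omin_line hS); exists s.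
rewrite /definable /defN /=.
by congr (S _); apply/predeqP => x /=; rewrite (stream_ord x ord0).
Qed.

Lemma definable_itvP (D : R -> Prop) : definable D -> exists s : seq (interval R),
  forall x, D x <-> exists2 I : interval R, I \in s & x \in I.
Proof.
rewrite /definable /defN /= => /(omin_line hS)[s hs]; exists s => x.
have := congr1 (fun A : set 'rV[R]_1 => A (\row_(i < 1) x)) hs.
by rewrite /= (stream_ord _ ord0) mxE => ->.
Qed.

Lemma definable_point (c : R) : definable (fun x => x = c).
Proof.
apply: definable_ext (definable_itv [:: `[c, c]]) => x; split.
  by case=> I; rewrite inE => /eqP ->; rewrite itv_boundlr/= => /andP[a b];
     apply/eqP; rewrite eq_le; apply/andP; split.
by move=> ->; exists `[c, c]; rewrite ?inE// bound_itvE.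
Qed.

(** Points of the line are degenerate intervals, hence definable; a point of any other type is
    described coordinate by coordinate. *)
Lemma definable_fun_cst U `{dU : Dtype R U} (c : U) : definable_fun (fun _ : T => c).
Proof.
apply: (definable_snd (P := fun u => u = c)).
have h : defN (ddim U) (fun e => forall i, (i < ddim U)%N -> e i = enc c i).
  apply: defN_forall => i hi.
  have H : definable (fun x : 'rV[R]_(ddim U) => x ord0 (Ordinal hi) = enc c i).
    apply: (definable_sub (h := fun x : 'rV[R]_(ddim U) => x ord0 (Ordinal hi))
      (f := fun=> i)) (definable_point (enc c i)) => // e /=.
    by rewrite mxE.
  by apply: defN_ext H => x /=; rewrite mxE.
apply: defN_ext h => x; split=> [h|<- i hi]; last by rewrite encK.
by rewrite -[RHS]decK; apply: dec_ext.
Qed.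

Lemma definable_fun_coord n (f : T -> 'rV[R]_n) (i : 'I_n) :
  definable_fun f -> definable_fun (fun t => f t ord0 i).
Proof.
apply: (definable_fun_comp (g := fun x : 'rV[R]_n => x ord0 i)).
apply: (definable_fun_sub (f := fun=> i)) => [j _|e] /=; first exact: ltn_ord.
by rewrite mxE.
Qed.

End Intervals.

Section Rows.
Context {T : Type} `{dT : Dtype R T}.

Lemma definable_fun_row n (f : T -> 'rV[R]_n) :
  (forall i, definable_fun (fun t => f t ord0 i)) -> definable_fun f.
Proof.
move=> h; have h1 : definable (fun p : T * 'rV[R]_n => forall i : 'I_n,
    p.2 ord0 i = f p.1 ord0 i).
  apply: definable_finall => i; apply: definable_eqf; first exact/definable_fun_coord/definable_fun_proj2.
  exact: (definable_fun_comp (h i)) (definable_fun_proj1).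
apply: definable_ext h1 => -[t x] /=; split=> [h1|-> //].
by apply/rowP => i; rewrite h1.
Qed.
End Rows.

Section Arithmetic.
Context {T : Type} `{dT : Dtype R T}.
Implicit Types f g : T -> R.

Lemma definable_fun_op3 (op : R -> R -> R) : S (n := 3)
    [set x | x ord0 (inord 2) = op (x ord0 (inord 0)) (x ord0 (inord 1))] ->
  forall f g, definable_fun f -> definable_fun g -> definable_fun (fun t => op (f t) (g t)).
Proof.
move=> /definable_row h f g hf hg.
have H : definable_fun (fun p : R * R => op p.1 p.2).
  refine (definable_ext _ (definable_comp (f := fun p : (R * R) * R => (\row_(i < 3)
    if i == 0%N :> nat then p.1.1 else if i == 1%N :> nat then p.1.2 else p.2)
    : 'rV[R]_3) _ h)) => [p|]; first by rewrite /= !mxE !inordK.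
  apply: definable_fun_row => i.
  apply: (definable_fun_ext (f := fun p : (R * R) * R => if i == 0%N :> nat then p.1.1
    else if i == 1%N :> nat then p.1.2 else p.2)) => [p|]; first by rewrite mxE.
  case: (i == 0%N :> nat) => /=; first exact/definable_fun_fst/definable_fun_proj1.
  by case: (i == 1%N :> nat); [exact/definable_fun_snd/definable_fun_proj1|exact/definable_fun_proj2].
exact: (definable_fun_comp (f := fun t => (f t, g t)) H (definable_fun_pair hf hg)).
Qed.

Lemma definable_fun_add f g : definable_fun f -> definable_fun g -> definable_fun (fun t => f t + g t).
Proof. exact: definable_fun_op3 (omin_add hS) f g. Qed.

Lemma definable_fun_mul f g : definable_fun f -> definable_fun g -> definable_fun (fun t => f t * g t).
Proof. exact: definable_fun_op3 (omin_mul hS) f g. Qed.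

Lemma definable_fun_opp f : definable_fun f -> definable_fun (fun t => - f t).
Proof.
move=> hf; apply: (definable_fun_ext (f := fun t => (-1) * f t)).
  by move=> t; rewrite mulN1r.
exact/definable_fun_mul/hf/definable_fun_cst.
Qed.

End Arithmetic.

Section Inequalities.
Context {T : Type} `{dT : Dtype R T}.
Implicit Types f g : T -> R.

(** The order comes from the field structure, as the nonnegative reals are the squares. *)
Lemma definable_le f g : definable_fun f -> definable_fun g -> definable (fun t => f t <= g t).
Proof.
move=> hf hg.
apply: definable_ext (_ : definable (fun t => exists z, g t = f t + z * z)) => [t|].
  split=> [[z ->]|h]; first by rewrite lerDl -expr2 sqr_ge0.
  exists (Num.sqrt (g t - f t)); rewrite -expr2 sqr_sqrtr ?subr_ge0//.
  by rewrite addrC subrK.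
apply: definable_ex; apply: definable_eqf; first exact: definable_fun_comp hg definable_fun_proj1.
apply: definable_fun_add; first exact: definable_fun_comp hf definable_fun_proj1.
by apply: definable_fun_mul; apply: definable_fun_proj2.
Qed.

Lemma definable_lt f g : definable_fun f -> definable_fun g -> definable (fun t => f t < g t).
Proof.
move=> hf hg; apply: definable_ext (definable_not (definable_le hg hf)) => t.
by rewrite ltNge; split=> /negP.
Qed.

Lemma definable_neq f g : definable_fun f -> definable_fun g -> definable (fun t => f t != g t).
Proof.
move=> hf hg; apply: definable_ext (definable_not (definable_eqf hf hg)) => t.
by split=> /eqP.
Qed.

End Inequalities.

Section RowOperations.
Context {T : Type} `{dT : Dtype R T}.

Lemma definable_andb (P Q : T -> bool) : definable (fun t => P t) -> definable (fun t => Q t) ->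
  definable (fun t => P t && Q t).
Proof.
move=> hP hQ; apply: definable_ext (definable_and hP hQ) => t.
by split=> [[-> ->]|/andP].
Qed.

Lemma definable_fun_addrow n (f g : T -> 'rV[R]_n) : definable_fun f -> definable_fun g ->
  definable_fun (fun t => f t + g t).
Proof.
move=> hf hg; apply: definable_fun_row => i.
apply: (definable_fun_ext (f := fun t => f t ord0 i + g t ord0 i)).
  by move=> t; rewrite mxE.
by apply: definable_fun_add; apply: definable_fun_coord.
Qed.

Lemma definable_fun_scalerow n (f : T -> R) (g : T -> 'rV[R]_n) : definable_fun f -> definable_fun g ->
  definable_fun (fun t => f t *: g t).
Proof.
move=> hf hg; apply: definable_fun_row => i.
apply: (definable_fun_ext (f := fun t => f t * g t ord0 i)).
  by move=> t; rewrite mxE.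
by apply: definable_fun_mul => //; apply: definable_fun_coord.
Qed.

Lemma definable_fun_vpair n (f : T -> 'rV[R]_n) (g : T -> R) : definable_fun f -> definable_fun g ->
  definable_fun (fun t => vpair (f t) (g t)).
Proof.
move=> hf hg; apply: definable_fun_row => i; case: (unliftP ord_max i) => [j|] hi.
  apply: (definable_fun_ext (f := fun t => f t ord0 j)); last exact: definable_fun_coord.
  by move=> t; rewrite mxE hi liftK.
by apply: (definable_fun_ext (f := g)) => // t; rewrite mxE hi unlift_none.
Qed.

Lemma definable_fun_butlast n (f : T -> 'rV[R]_n.+1) : definable_fun f ->
  definable_fun (fun t => butlast (f t)).
Proof.
move=> hf; apply: definable_fun_row => i.
apply: (definable_fun_ext (f := fun t => f t ord0 (lift ord_max i))).
  by move=> t; rewrite mxE.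
exact: definable_fun_coord.
Qed.

Lemma definable_fun_vlast n (f : T -> 'rV[R]_n.+1) : definable_fun f -> definable_fun (fun t => vlast (f t)).
Proof. exact: definable_fun_coord. Qed.
End RowOperations.

Section AbsoluteValue.
Context {T : Type} `{dT : Dtype R T}.

Lemma definable_fun_norm (f : T -> R) : definable_fun f -> definable_fun (fun t => `|f t|).
Proof.
move=> hf; apply: (definable_fun_comp (g := fun x : R => `|x|)) hf.
apply: (definable_ext (P := fun p : R * R => (0 <= p.1 /\ p.2 = p.1) \/
                                     (p.1 < 0 /\ p.2 = - p.1))).
  move=> [x y] /=; have [h|h] := leP 0 x.
    by rewrite ger0_norm//; split=> [[[]|[]]|]//; left.
  by rewrite ltr0_norm//; split=> [[[]|[]]|]//; right.
have h1 := @definable_fun_proj1 R R _ _; have h2 := @definable_fun_proj2 R R _ _.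
apply: definable_or; apply: definable_and.
- by apply: definable_le => //; apply: definable_fun_cst.
- exact: definable_eqf.
- by apply: definable_lt => //; apply: definable_fun_cst.
- by apply: definable_eqf => //; apply: definable_fun_opp.
Qed.

End AbsoluteValue.
End Definability.

(** The head symbol of the formula selects the closure lemma, and predicates or functions known to
    be definable act as atoms. Quantifiers over ordinals are matched before the general ones: they
    are finite conjunctions and disjunctions over a type that is not coded by reals. *)
Ltac definability_step hS :=
  cbv beta;
  first [match goal with
  | H : definable ?P |- definable ?P => exact H
  | H : definable_fun ?f |- definable_fun ?f => exact H
  end | lazymatch goal with
  | |- definable (fun _ => ?Q) => refine (definable_const hS Q)
  | |- definable (fun u => @?A u /\ @?B u) => refine (definable_and hS _ _)
  | |- definable (fun u => @?A u \/ @?B u) => refine (definable_or hS _ _)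
  | |- definable (fun u => ~ @?A u) => refine (definable_not hS _)
  | |- definable (fun u => @?A u <-> @?B u) => refine (definable_iff hS _ _)
  | |- definable (fun u => exists i : 'I_ _, _) => refine (definable_finex hS _); intro
  | |- definable (fun u => forall i : 'I_ _, _) => refine (definable_finall hS _); intro
  | |- definable (fun u => exists t, _) => refine (definable_ex hS _)
  | |- definable (fun u => exists2 t, _ & _) => refine (definable_ex2 hS _)
  | |- definable (fun u => @?A u -> @?B u) => refine (definable_imp hS _ _)
  | |- definable (fun u => forall t, _) => refine (definable_all hS _)
  | |- definable (fun u => @?A u = @?B u) => refine (definable_eqf hS _ _)
  | |- definable (fun u => is_true (~~ (@?A u == @?B u))) => refine (definable_neq hS _ _)
  | |- definable (fun u => is_true (@?A u && @?B u)) => refine (definable_andb hS _ _)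
  | |- definable (fun u => is_true (@?A u <= @?B u)) => refine (definable_le hS _ _)
  | |- definable (fun u => is_true (@?A u < @?B u)) => refine (definable_lt hS _ _)
  | H : definable ?P |- definable (fun u => ?P (@?g u)) => refine (definable_comp hS _ H)
  | |- definable_fun (pair ?c) => refine (definable_fun_pair hS (definable_fun_cst hS c) (definable_fun_id hS))
  | |- definable_fun (vpair ?c) => refine (definable_fun_vpair hS (definable_fun_cst hS c) (definable_fun_id hS))
  | H : definable (fun p => ?P (fst p) (snd p)) |- definable (fun u => ?P (@?A u) (@?B u)) =>
      refine (definable_comp hS (f := fun u => (A u, B u)) _ H)
  | H : definable_fun (fun p => ?P (fst p) (snd p)) |- definable_fun (fun u => ?P (@?A u) (@?B u)) =>
      refine (definable_fun_comp hS H (f := fun u => (A u, B u)) _)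
  | |- definable_fun (@GRing.opp _) => refine (definable_fun_opp hS (definable_fun_id hS))
  | |- definable_fun (GRing.add ?c) => refine (definable_fun_add hS (definable_fun_cst hS c) (definable_fun_id hS))
  | |- definable_fun (GRing.mul ?c) => refine (definable_fun_mul hS (definable_fun_cst hS c) (definable_fun_id hS))
  | |- definable_fun (@butlast _ _) => refine (definable_fun_butlast hS (definable_fun_id hS))
  | |- definable_fun (@vlast _ _) => refine (definable_fun_vlast hS (definable_fun_id hS))
  | |- definable_fun fst => refine (definable_fun_proj1 hS)
  | |- definable_fun snd => refine (definable_fun_proj2 hS)
  | |- definable_fun (fun u => u) => refine (definable_fun_id hS)
  | |- definable_fun (fun _ => ?c) => refine (definable_fun_cst hS c)
  | |- definable_fun (fun u => fst (@?A u)) => refine (definable_fun_fst hS _)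
  | |- definable_fun (fun u => snd (@?A u)) => refine (definable_fun_snd hS _)
  | |- definable_fun (fun u => (@?A u, @?B u)) => refine (definable_fun_pair hS _ _)
  | |- definable_fun (fun u => @?A u + @?B u) =>
      first [refine (definable_fun_add hS _ _) | refine (definable_fun_addrow hS _ _)]
  | |- definable_fun (fun u => @?A u * @?B u) => refine (definable_fun_mul hS _ _)
  | |- definable_fun (fun u => @?A u *: @?B u) => refine (definable_fun_scalerow hS _ _)
  | |- definable_fun (fun u => - @?A u) => refine (definable_fun_opp hS _)
  | |- definable_fun (fun u => Num.norm (@?A u)) => refine (definable_fun_norm hS _)
  | |- definable_fun (fun u => vpair (@?A u) (@?B u)) => refine (definable_fun_vpair hS _ _)
  | |- definable_fun (fun u => butlast (@?A u)) => refine (definable_fun_butlast hS _)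
  | |- definable_fun (fun u => vlast (@?A u)) => refine (definable_fun_vlast hS _)
  | |- definable_fun (fun u => fun_of_matrix (@?A u) ord0 ?i) => refine (definable_fun_coord hS _ _)
  | H : definable_fun ?F |- definable_fun (fun u => ?F (@?g u)) => refine (definable_fun_comp hS H _)
  end].

Ltac definability :=
  match goal with hS : o_minimal_structure _ |- _ => repeat definability_step hS end.

(** * Definable subsets of the line *)

Section RealSets.
Context {R : realType}.
Implicit Types (D : R -> Prop) (x y : R).

(** Two inequalities rather than an absolute value: the formula is first-order and suits linear
    arithmetic. *)
Definition nearby x (e : R) y : Prop := x - e < y /\ y < x + e.

Definition boundary_pt D x : Prop := forall e, 0 < e ->
  (exists y, nearby x e y /\ D y) /\ (exists y, nearby x e y /\ ~ D y).

Definition loc_const D x : Prop :=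
  exists e, 0 < e /\ forall y, nearby x e y -> (D y <-> D x).

Definition fin D : Prop := exists s : seq R, forall x, D x -> x \in s.

(** The minimum of finitely many radii serves all of them, as [P a] passes to smaller radii. *)
Lemma seq_common_radius (A : eqType) (s : seq A) (P : A -> R -> Prop) :
  (forall a e e', P a e -> 0 < e' -> e' <= e -> P a e') ->
  (forall a, a \in s -> exists e, 0 < e /\ P a e) ->
  exists e, 0 < e /\ forall a, a \in s -> P a e.
Proof.
move=> hP; elim: s => [|a s IH] h; first by exists 1.
have [e1 [e10 h1]] := h a (mem_head _ _).
have [b hb|e2 [e20 h2]] := IH; first by apply: h; rewrite inE hb orbT.
exists (Num.min e1 e2); split; first by rewrite lt_min e10.
have hm : 0 < Num.min e1 e2 by rewrite lt_min e10.
move=> b; rewrite inE => /predU1P[->|/h2 hb].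
  by apply: hP h1 _ _ => //; rewrite ge_min lexx.
by apply: hP hb _ _ => //; rewrite ge_min lexx orbT.
Qed.

Lemma nearby_refl x e : 0 < e -> nearby x e x.
Proof. by rewrite /nearby => h; split; lra. Qed.

Lemma nearby_sub x e e' y : e' <= e -> nearby x e' y -> nearby x e y.
Proof. by rewrite /nearby => h [h1 h2]; split; lra. Qed.

Lemma loc_constP D x : loc_const D x <-> ~ boundary_pt D x.
Proof.
split=> [[e [e0 h]] /(_ e e0)[[y [hy Dy]] [z [hz nDz]]]|].
  by apply: nDz; apply/(h z hz)/(h y hy).
move=> h; apply: contrapT => nlc; apply: h => e e0.
split; apply: contrapT => H; apply: nlc; exists e; split=> // y hy; split=> hD.
- by exfalso; apply: H; exists y.
- by exfalso; apply: H; exists x; split=> //; exact: nearby_refl.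
- by apply: contrapT => hn; apply: H; exists x; split=> //; exact: nearby_refl.
- by apply: contrapT => hn; apply: H; exists y.
Qed.

Lemma loc_const_and D D' x : loc_const D x -> loc_const D' x -> loc_const (fun y => D y /\ D' y) x.
Proof.
move=> [e1 [e10 h1]] [e2 [e20 h2]]; exists (Num.min e1 e2).
split=> [|y hy]; first by rewrite lt_min e10.
have hy1 : D y <-> D x by apply/h1/(nearby_sub _ hy); rewrite ge_min lexx.
have hy2 : D' y <-> D' x.
  by apply/h2/(nearby_sub _ hy); rewrite ge_min lexx orbT.
tauto.
Qed.

Lemma loc_const_ext D D' x : (forall y, D y <-> D' y) -> loc_const D x -> loc_const D' x.
Proof.
move=> h [e [e0 h1]]; exists e; split=> // y hy.
by rewrite -!h; exact: h1.
Qed.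

Lemma loc_const_not D x : loc_const D x -> loc_const (fun y => ~ D y) x.
Proof.
by move=> [e [e0 h1]]; exists e; split=> // y /h1 h; tauto.
Qed.

Lemma loc_const_true x : loc_const (fun=> True) x.
Proof. by exists 1; split. Qed.

Lemma loc_const_lt a x : x != a -> loc_const (fun y => y < a) x.
Proof.
move=> h; exists `|x - a|; split; first by rewrite normr_gt0 subr_eq0.
move=> y [h1 h2]; case: (ltgtP x a) h h1 h2 => // h _.
  rewrite ltr0_norm ?subr_lt0// => h1 h2; split=> _; lra.
rewrite gtr0_norm ?subr_gt0// => h1 h2; split => // ?; lra.
Qed.

Lemma loc_const_gt a x : x != a -> loc_const (fun y => a < y) x.
Proof.
move=> h; exists `|x - a|; split; first by rewrite normr_gt0 subr_eq0.
move=> y [h1 h2]; case: (ltgtP x a) h h1 h2 => // h _.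
  rewrite ltr0_norm ?subr_lt0// => h1 h2; split => // ?; lra.
rewrite gtr0_norm ?subr_gt0// => h1 h2; split=> _; lra.
Qed.

Lemma loc_const_le a x : x != a -> loc_const (fun y => y <= a) x.
Proof.
move=> /loc_const_gt/loc_const_not; apply: loc_const_ext => y.
by rewrite leNgt; split=> /negP.
Qed.

Lemma loc_const_ge a x : x != a -> loc_const (fun y => a <= y) x.
Proof.
move=> /loc_const_lt/loc_const_not; apply: loc_const_ext => y.
by rewrite leNgt; split=> /negP.
Qed.

Definition itv_ends (I : interval R) : seq R :=
  (if I.1 is BSide _ a then [:: a] else [::]) ++
  (if I.2 is BSide _ a then [:: a] else [::]).

Lemma loc_const_itv (I : interval R) x : x \notin itv_ends I -> loc_const (fun y => y \in I) x.
Proof.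
have h (A B : R -> bool) : loc_const A x -> loc_const B x -> loc_const (fun y => A y && B y) x.
  move=> h1 h2; apply: loc_const_ext (loc_const_and h1 h2) => y.
  by split=> [[-> ->]|/andP].
case: I => [a b]; rewrite mem_cat negb_or => /andP[ha hb].
suff : loc_const (fun y => (a <= BLeft y)%O && (BRight y <= b)%O) x.
  by apply: loc_const_ext => y; rewrite itv_boundlr.
apply: h.
- clear hb; case: a ha => [[] a|[]] /=; rewrite ?inE => ha.
  + by apply: loc_const_ext (loc_const_ge ha) => y; rewrite bnd_simp.
  + by apply: loc_const_ext (loc_const_gt ha) => y; rewrite bnd_simp.
  + by apply: loc_const_ext (loc_const_true x) => y; rewrite bnd_simp.
  + by apply: loc_const_ext (loc_const_not (loc_const_true x)) => y; rewrite bnd_simp; split => // /(_ I).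
- clear ha; case: b hb => [[] b|[]] /=; rewrite ?inE => hb.
  + by apply: loc_const_ext (loc_const_lt hb) => y; rewrite bnd_simp.
  + by apply: loc_const_ext (loc_const_le hb) => y; rewrite bnd_simp.
  + by apply: loc_const_ext (loc_const_not (loc_const_true x)) => y; rewrite bnd_simp; split => // /(_ I).
  + by apply: loc_const_ext (loc_const_true x) => y; rewrite bnd_simp.
Qed.

Lemma loc_const_ex_seq (A : eqType) (s : seq A) (P : A -> R -> Prop) x :
  (forall a, a \in s -> loc_const (P a) x) -> loc_const (fun y => exists2 a, a \in s & P a y) x.
Proof.
move=> h; have [|e [e0 he]] := @seq_common_radius A s
    (fun a e => forall y, nearby x e y -> (P a y <-> P a x)) _ h.
  by move=> a e e' ha _ le y /(nearby_sub le)/ha.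
exists e; split=> // y hy; split=> -[a ha hP]; exists a => //.
  exact/(he a ha y hy).
exact/(he a ha y hy).
Qed.

(** The supremum of the points of [D] in the segment is such a boundary point. *)
Lemma boundary_between D a b : a < b -> D a -> ~ D b ->
  exists c, a <= c /\ c <= b /\ boundary_pt D c.
Proof.
move=> ab Da nDb; pose E := [set y | a <= y /\ y <= b /\ D y].
have hE : has_sup E.
  split; first by exists a; rewrite /E /= lexx ltW.
  by exists b => y [_ []].
have aE : a <= sup E by apply: sup_upper_bound => //; rewrite /E /= lexx ltW.
have Eb : sup E <= b by apply: ge_sup; [case: hE|move=> y [_ []]].
exists (sup E); split => //; split => // e e0; split.
  have [y [ay [yb Dy]] hy] := sup_adherent e0 hE.
  exists y; split => //; split => //.
  have /= : y <= sup E by apply: sup_upper_bound.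
  by lra.
have [h|h] := ltP (sup E) b; last first.
  by exists b; split => //; rewrite /nearby; split; lra.
exists (Num.min (sup E + e / 2) b).
have h1 : sup E < Num.min (sup E + e / 2) b by rewrite lt_min h andbT; lra.
split.
  split; first by lra.
  by rewrite gt_min; apply/orP; left; lra.
move=> hD; suff : Num.min (sup E + e / 2) b <= sup E by lra.
apply: sup_upper_bound => //; split; first by lra.
by split=> //; rewrite ge_min lexx orbT.
Qed.

(** This is connectedness of the segment: different truth values at the ends would force a boundary
    point in between. *)
Lemma loc_const_segment D a b : (forall x, a <= x -> x <= b -> loc_const D x) ->
  a <= b -> (D a <-> D b).
Proof.
move=> h; rewrite le_eqVlt => /predU1P[-> //|ab].
split=> hD; apply: contrapT => hn.
  have [c [ac [cb hb]]] := boundary_between ab hD hn.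
  by have /loc_constP := h c ac cb.
have [c [ac [cb hb]]] := @boundary_between (fun y => ~ D y) a b ab hn (fun f => f hD).
by have /loc_constP := loc_const_not (h c ac cb).
Qed.

Lemma rat_between (a b : R) : a < b -> exists q : rat, a < ratr q /\ ratr q < b.
Proof.
move=> /rat_in_itvoo[q]; rewrite in_itv /= => /andP[h1 h2].
by exists q.
Qed.

(** Countable sets have Lebesgue measure zero, whereas the interval has measure [b - a]. *)
Lemma itv_not_countable (a b : R) : a < b ->
  ~ countable [set x | a < x /\ x < b].
Proof.
move=> ab h.
have := countable_lebesgue_measure0 h.
have -> : [set x | a < x /\ x < b] = [set` `]a, b[].
  by apply/predeqP => x /=; rewrite in_itv /=; split=> [[-> ->]|/andP].
rewrite lebesgue_measure_itv /= lte_fin ab => /eqP.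
by rewrite -EFinB eqe subr_eq0 => /eqP h1; rewrite h1 ltxx in ab.
Qed.

Lemma fin_sub D D' : (forall x, D x -> D' x) -> fin D' -> fin D.
Proof. by move=> h [s hs]; exists s => x /h/hs. Qed.

Lemma fin_or D D' : fin D -> fin D' -> fin (fun x => D x \/ D' x).
Proof.
move=> [s hs] [s' hs']; exists (s ++ s') => x; rewrite mem_cat.
by move=> [/hs ->|/hs' ->]; rewrite ?orbT.
Qed.

Lemma fin_not_itv D a b : fin D -> a < b ->
  exists x, a < x /\ x < b /\ ~ D x.
Proof.
move=> [s hs] ab; apply: contrapT => h; apply: (itv_not_countable ab).
apply: sub_countable (finite_set_countable (finite_seq s)).
apply: subset_card_le => x /= [h1 h2]; apply: hs; apply: contrapT => h3.
by apply: h; exists x.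
Qed.

End RealSets.

(** * Consequences of o-minimality on the line *)

Section OneDim.
Context {R : realType} {S : forall n : nat, set (set 'rV[R]_n)}.
Hypothesis hS : o_minimal_structure S.
Local Notation ddef := (@definable R S _ _).
Local Notation dfun := (@definable_fun R S _ _ _ _).
Implicit Types (D : R -> Prop) (x y : R).

(** By o-minimality [D] is a finite union of intervals, and it is locally constant away from their
    endpoints. *)
Lemma fin_boundary D : ddef D -> fin (boundary_pt D).
Proof.
move=> /(definable_itvP hS)[s hs]; exists (flatten [seq itv_ends J | J <- s]) => x.
apply: contraPT => hx; apply/loc_constP.
apply: loc_const_ext (loc_const_ex_seq (s := s) (P := fun (I : interval R) (x : R) => x \in I) _) => [y|I hI].
  by symmetry; apply: hs.
apply: loc_const_itv; apply: contra hx => hx; apply/flattenP.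
by exists (itv_ends I) => //; apply/mapP; exists I.
Qed.

(** A point of [D] off the finite boundary has a whole neighbourhood in [D]. *)
Lemma infinite_itv D : ddef D -> ~ fin D ->
  exists a b, a < b /\ forall x, a < x -> x < b -> D x.
Proof.
move=> dD nf; apply: contrapT => h; apply: nf.
apply: fin_sub (fin_boundary dD) => x Dx; apply: contrapT => /loc_constP[e [e0 he]].
apply: h; exists (x - e), (x + e); split; first by lra.
by move=> y h1 h2; apply/he.
Qed.

Lemma Baire1 (I : countType) (E : I -> R -> Prop) (a b : R) :
  (forall i, ddef (E i)) -> a < b ->
  (forall x, a < x -> x < b -> exists i, E i x) ->
  exists i c d, a < c /\ c < d /\ d < b /\
    forall x, c < x -> x < d -> E i x.
Proof.
move=> dE ab cov; apply: contrapT => hno.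
have hf i : fin (fun x => E i x /\ (a < x /\ x < b)).
  apply: contrapT => /infinite_itv[|c [d [cd h]]].
    by have := dE i; move=> ?; definability.
  (* The interval found may share an end with the given one; its middle third has both ends strictly
     inside. *)
  apply: hno; exists i, ((2 * c + d) / 3), ((c + 2 * d) / 3).
  have [h1 [h2 h3]] := h ((2 * c + d) / 3) ltac:(lra) ltac:(lra).
  have [h4 [h5 h6]] := h ((c + 2 * d) / 3) ltac:(lra) ltac:(lra).
  split => //; split; first by lra.
  by split => // x hx1 hx2; have [] := h x ltac:(lra) ltac:(lra).
apply: (itv_not_countable ab).
have : countable (\bigcup_(i in [set: I]) [set x | E i x /\ (a < x /\ x < b)]).
  apply: bigcup_countable => [|i _]; first exact: countableP.
  have [s hs] := hf i.
  apply: sub_countable (finite_set_countable (finite_seq s)).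
  exact: subset_card_le.
apply: sub_countable; apply: subset_card_le => x [h1 h2].
by have [i hi] := cov x h1 h2; exists i.
Qed.

Lemma definable_boundary T (dT : Dtype R T) (Y : T * R -> Prop) : ddef Y ->
  ddef (fun p : T * R => boundary_pt (fun t => Y (p.1, t)) p.2).
Proof. by move=> h; rewrite /boundary_pt /nearby; definability. Qed.

Lemma definable_boundary1 D : ddef D -> ddef (boundary_pt D).
Proof. by move=> h; rewrite /boundary_pt /nearby; definability. Qed.

(** Otherwise the boundaries of the [E i] cover the interval, and by [Baire1] one of them contains
    an interval, although it is finite. *)
Lemma generic_point (I : countType) (E : I -> R -> Prop) (a b : R) :
  (forall i, ddef (E i)) -> a < b ->
  exists x, a < x /\ x < b /\ forall i, loc_const (E i) x.
Proof.
move=> dE ab; apply: contrapT => hno.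
have [x h1 h2|i [c [d [h1 [cd [h2 h]]]]]] :=
  @Baire1 I (fun i => boundary_pt (E i)) a b (fun i => definable_boundary1 (dE i)) ab.
  apply: contrapT => h3; apply: hno; exists x; split => //; split => // i.
  by apply/loc_constP => h4; apply: h3; exists i.
have [x [h3 [h4 h5]]] := fin_not_itv (fin_boundary (dE i)) cd.
by apply: h5; apply: h.
Qed.

End OneDim.

(** * Uniform finiteness *)

Section Rank.
Context {R : realType}.
Implicit Types (A B : R -> Prop).

(* At least [k] elements of [A] lie below [t]; as a first-order formula, this
   lets cardinality bounds on the fibres of a family be handled definably. *)
Fixpoint rk A k t : Prop :=
  if k is k'.+1 then exists t', t' < t /\ A t' /\ rk A k' t' else True.

(** The elements are numbered from 0 in increasing order. *)
Definition nth_elem A j t : Prop := A t /\ rk A j t /\ ~ rk A j.+1 t.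

Lemma rk_le A k t t' : t <= t' -> rk A k t -> rk A k t'.
Proof.
case: k => //= k h [u [h1 h2]]; exists u; split => //; exact: lt_le_trans h1 h.
Qed.

Lemma rkS A k t : rk A k.+1 t -> rk A k t.
Proof. by move=> /= [u [h1 [_ h2]]]; apply: rk_le h2; exact: ltW. Qed.

Lemma rk_leq A j k t : (j <= k)%N -> rk A k t -> rk A j t.
Proof.
move=> /subnKC <-; elim: (k - j)%N => [|m IH]; first by rewrite addn0.
by rewrite addnS => /rkS.
Qed.

Lemma rk_sub A B k t : (forall x, A x -> B x) -> rk A k t -> rk B k t.
Proof.
move=> h; elim: k t => //= k IH t [u [h1 [h2 h3]]].
by exists u; split => //; split; [exact: h|exact: IH].
Qed.

Lemma rk_seq A k t : rk A k t -> exists s : seq R,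
  uniq s /\ size s = k /\ forall x, x \in s -> A x /\ x < t.
Proof.
elim: k t => [|k IH] t; first by exists [::].
move=> /= [u [ut [Au /IH[s [us [sk hs]]]]]]; exists (u :: s); split => /=.
  by rewrite us andbT; apply/negP => /hs[_]; rewrite ltxx.
split; first by rewrite sk.
by move=> x; rewrite inE => /predU1P[->//|/hs[Ax xu]]; split; last exact: lt_trans ut.
Qed.

Lemma fin_rk A : fin A -> exists N, forall t, ~ rk A N t.
Proof.
move=> [s hs]; exists (size s).+1 => t /rk_seq[l [ul [sl hl]]].
have : (size l <= size s)%N by apply: uniq_leq_size => // x /hl[/hs].
by rewrite sl ltnn.
Qed.

Lemma nth_elem_ex A N t : A t -> ~ rk A N t -> exists j, (j < N)%N /\ nth_elem A j t.
Proof.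
move=> At; elim: N => [|N IH] h; first by case: h.
have [h1|/IH[j [jN hj]]] := pselect (rk A N t); first by exists N.
by exists j; split => //; apply: ltnW.
Qed.

Lemma nth_elem_inj A j t t' : nth_elem A j t -> nth_elem A j t' -> t = t'.
Proof.
move=> [At [h1 h2]] [At' [h1' h2']]; case: (ltgtP t t') => // h; exfalso.
  by apply: h2'; exists t.
by apply: h2; exists t'.
Qed.

(** Being at distance less than [eta] is the graph of a bijection between [A] and [B]. *)
Definition matching eta A B : Prop :=
  (forall a, A a -> exists b, B b /\ nearby a eta b /\
     forall b', B b' -> nearby a eta b' -> b' = b) /\
  (forall b, B b -> exists a, A a /\ nearby a eta b /\
     forall a', A a' -> nearby a' eta b -> a' = a).

(** If the order were reversed, [b] would also be close to [a'], and so would have two partners in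
    [A]. *)
Lemma matching_mono eta A B a a' b b' : matching eta A B ->
  A a -> A a' -> B b -> B b' -> nearby a eta b -> nearby a' eta b' ->
  a < a' -> b < b'.
Proof.
move=> [hA hB] Aa Aa' Bb Bb' h h' aa'; rewrite ltNge; apply/negP => bb'.
have h2 : nearby a' eta b by move: h h'; rewrite /nearby; split; lra.
have [c [_ [_ hc]]] := hB b Bb.
by move: aa'; rewrite (hc a) // (hc a') // ltxx.
Qed.

Lemma matching_rk eta A B k a b : matching eta A B -> A a -> B b ->
  nearby a eta b -> (rk A k a <-> rk B k b).
Proof.
move=> hm; elim: k a b => //= k IH a b Aa Bb h; split=> -[t [ht [At rt]]].
  have [u [Bu [hu _]]] := hm.1 t At; exists u; split.
    exact: (matching_mono hm At Aa).
  by split=> //; apply/(IH t u).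
have [u [Au [hu _]]] := hm.2 t At; exists u; split; last first.
  by split=> //; apply/(IH u t).
case: (ltgtP u a) => // [h1|h1].
  by have := matching_mono hm Aa Au Bb At h hu h1; rewrite ltNge (ltW ht).
rewrite h1 in hu; have [c [Bc [hc uc]]] := hm.1 a Aa.
by move: ht; rewrite (uc t) // (uc b) // ltxx.
Qed.

(** Beware of the shift: this means that [A] has at least [k + 1] elements. *)
Definition has_rk A k := exists t, A t /\ rk A k t.

Lemma matching_has_rk eta A B k : matching eta A B ->
  (has_rk A k <-> has_rk B k).
Proof.
move=> hm; split=> -[t [At rt]].
  have [u [Bu [hu _]]] := hm.1 t At; exists u; split=> //.
  by apply/(matching_rk k hm At).
have [u [Au [hu _]]] := hm.2 t At; exists u; split=> //.
by apply/(matching_rk k hm Au At).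
Qed.

(* A first-order substitute for local constancy of the cardinality of the
   fibres of [Y]: the matching preserves the order, hence the ranks. *)
Definition stable (Y : R * R -> Prop) s0 : Prop :=
  exists eta, 0 < eta /\ exists delta, 0 < delta /\ forall s, nearby s0 delta s ->
    matching eta (fun t => Y (s0, t)) (fun t => Y (s, t)).

Lemma stable_loc_const Y s0 k : stable Y s0 ->
  loc_const (fun s => has_rk (fun t => Y (s, t)) k) s0.
Proof.
move=> [eta [_ [d [d0 h]]]]; exists d; split => // s /h hm.
by rewrite -(matching_has_rk k hm).
Qed.

Lemma fin_gap A : fin A -> exists e, 0 < e /\
  forall a a', A a -> A a' -> nearby a e a' -> a = a'.
Proof.
move=> [s hs].
have [| |e [e0 he]] := @seq_common_radius R _ [seq (a, a') | a <- s, a' <- s]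
    (fun p e => nearby p.1 e p.2 -> p.1 = p.2).
- by move=> a e e' ha _ le /(nearby_sub le)/ha.
- move=> [a a'] _ /=; have [->|/eqP ne] := pselect (a = a').
    by exists 1; split.
  exists `|a - a'|; split; first by rewrite normr_gt0 subr_eq0.
  move=> [h1 h2]; exfalso; case: (ltgtP a a') ne h1 h2 => // h _.
    by rewrite ltr0_norm ?subr_lt0//; lra.
  by rewrite gtr0_norm ?subr_gt0//; lra.
exists e; split=> // a a' /hs ha /hs ha'; apply: (he (a, a')).
exact: allpairs_f.
Qed.

(** Each pair holds the centre and the radius of a rational ball, so that only countably many finite
    unions of balls occur. *)
Fixpoint uncovered (l : seq (rat * rat)) (t : R) : Prop :=
  if l is p :: l' then ~ nearby (ratr p.1) (ratr p.2) t /\ uncovered l' t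
  else True.

Lemma uncoveredP l t : (uncovered l t) <->
  forall p, p \in l -> ~ nearby (ratr p.1) (ratr p.2) t.
Proof.
elim: l => [|p l IH] //=; rewrite IH; split=> [[h1 h2] q|h].
  by rewrite inE => /predU1P[->|/h2].
by split=> [|q hq]; apply: h; rewrite inE ?eqxx// hq orbT.
Qed.

(* Rational balls separate the points of the finite fibre over [s0], so that
   countably many definable conditions control the nearby fibres. *)
Lemma stable_of_loc_const (Y : R * R -> Prop) s0 : fin (fun t => Y (s0, t)) ->
  (forall l : seq (rat * rat),
     loc_const (fun s => exists t, Y (s, t) /\ uncovered l t) s0) ->
  (forall p : rat * rat,
     loc_const (fun s => exists t, Y (s, t) /\ nearby (ratr p.1) (ratr p.2) t) s0) ->
  (forall p : rat * rat,
     loc_const (fun s => exists t, exists t', t < t' /\ Y (s, t) /\ Y (s, t') /\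
       nearby (ratr p.1) (ratr p.2) t /\ nearby (ratr p.1) (ratr p.2) t') s0) ->
  stable Y s0.
Proof.
move=> hf h0 h1 h2.
have [e [e0 gap]] := fin_gap hf.
(* Below a quarter of the gap, the rational ball attached to a point of the fibre over [s0] contains
   no other point of that fibre and stays within [e / 2] of its own, which is the matching distance
   chosen below. *)
have [r [r0 re]] := @rat_between R 0 (e / 4) ltac:(lra).
have /choice[q hq] : forall a : R, exists q : rat,
    a - ratr r < ratr q /\ ratr q < a + ratr r.
  by move=> a; apply: rat_between; lra.
have [sA hsA] := hf.
pose s := [seq a <- sA | `[< Y (s0, a) >]].
have hs a : a \in s <-> Y (s0, a).
  rewrite mem_filter; split=> [/andP[/asboolP]//|Ya].
  by rewrite hsA // andbT; apply/asboolP.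
pose L := [seq (q a, r) | a <- s].
have [dL [dL0 hL]] := h0 L.
(* Nearby fibres keep exactly one point in each ball: [h1] gives existence and [h2] uniqueness. *)
have [| |d [d0 hd]] := @seq_common_radius R _ s (fun a d => forall s', nearby s0 d s' ->
   (exists t, Y (s', t) /\ nearby (ratr (q a)) (ratr r) t) /\
   (forall t t', Y (s', t) -> Y (s', t') -> nearby (ratr (q a)) (ratr r) t ->
      nearby (ratr (q a)) (ratr r) t' -> t = t')).
- by move=> a d d' ha _ le s' /(nearby_sub le)/ha.
- move=> a /hs Ya.
  have [d1 [d10 hd1]] := h1 (q a, r); have [d2 [d20 hd2]] := h2 (q a, r).
  exists (Num.min d1 d2); split=> [|s' hs']; first by rewrite lt_min d10.
  have hs1 : nearby s0 d1 s' by apply: nearby_sub hs'; rewrite ge_min lexx.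
  have hs2 : nearby s0 d2 s' by apply: nearby_sub hs'; rewrite ge_min lexx orbT.
  split.
    apply/(hd1 _ hs1); exists a; split => //=.
    by have := hq a; rewrite /nearby; split; lra.
  have {}hd2 : ~ exists t t', t < t' /\ Y (s', t) /\ Y (s', t') /\
     nearby (ratr (q a)) (ratr r) t /\ nearby (ratr (q a)) (ratr r) t'.
    move=> /(hd2 _ hs2)[t [t' [tt' [Yt [Yt' [nt nt']]]]]].
    suff : t = t' by move=> E; rewrite E ltxx in tt'.
    by apply: gap => //; move: nt nt'; rewrite /nearby /=; split; lra.
  move=> t t' Yt Yt' nt nt'; case: (ltgtP t t') => // tt'; exfalso.
    by apply: hd2; exists t, t'.
  by apply: hd2; exists t', t.
exists (e / 2); split; first by lra.
exists (Num.min d dL); split; first by rewrite lt_min d0.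
move=> s' hs'.
have hs1 : nearby s0 d s' by apply: nearby_sub hs'; rewrite ge_min lexx.
have hs2 : nearby s0 dL s' by apply: nearby_sub hs'; rewrite ge_min lexx orbT.
(* Nearby fibres have no point outside the balls, since the fibre over [s0] has none. *)
have cov t : Y (s', t) -> exists a, Y (s0, a) /\ nearby (ratr (q a)) (ratr r) t.
  move=> Yt; apply: contrapT => hno.
  suff : exists t, Y (s', t) /\ uncovered L t.
    move=> /(hL _ hs2)[a [Ya /uncoveredP]] /(_ (q a, r)); apply.
      by apply/mapP; exists a => //; apply/hs.
    by have := hq a; rewrite /nearby /=; split; lra.
  exists t; split=> //; apply/uncoveredP => p /mapP[a /hs Ya ->] /= hn.
  by apply: hno; exists a.
split.
  move=> a Ya; have [[b [Yb nb]] hu] := hd a (proj2 (hs a) Ya) _ hs1.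
  have qa := hq a.
  exists b; split => //; split.
    by move: nb; rewrite /nearby; split; lra.
  move=> b' Yb' nb'; have [c [Yc nc]] := cov b' Yb'; have qc := hq c.
  have ac : a = c by apply: gap => //; move: nb' nc; rewrite /nearby; split; lra.
  by apply: hu => //; rewrite ac.
move=> b Yb; have [a [Ya na]] := cov b Yb; have qa := hq a; exists a; split => //.
split; first by move: na; rewrite /nearby; split; lra.
move=> a' Ya' na'; apply: gap => //; move: na na'; rewrite /nearby; split; lra.
Qed.

(* Every real outside a finite set lies in the same component of its complement
   as one of finitely many test points. *)
Definition test_point (B : R -> Prop) x : Prop :=
  B x \/ x = 0 \/ (exists b, B b /\ (x = b + 1 \/ x = b - 1)) \/
  (exists b b', B b /\ B b' /\ x + x = b + b').

Lemma fin_test_point B : fin B -> fin (test_point B).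
Proof.
move=> [s hs]; exists (s ++ 0 :: [seq b + 1 | b <- s] ++ [seq b - 1 | b <- s] ++
  [seq (b + b') / 2 | b <- s, b' <- s]) => x.
rewrite !(mem_cat, inE) => -[/hs ->//|[->|[[b [/hs hb hx]]|]]].
- by rewrite eqxx orbT.
- case: hx => ->; first by rewrite (map_f (fun b => b + 1)) ?orbT.
  by rewrite (map_f (fun b => b - 1)) ?orbT.
- move=> [b [b' [/hs hb [/hs hb' hx]]]]; have -> : x = (b + b') / 2 by lra.
  by rewrite (allpairs_f (fun b b' => (b + b') / 2)) ?orbT.
Qed.

Lemma fin_max_below B x : fin B -> (forall b, B b -> ~ b < x) \/
  exists b, B b /\ b < x /\ forall b', B b' -> b' < x -> b' <= b.
Proof.
move=> [s]; elim: s B => [|a s IH] B hs.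
  by left=> b /hs.
have [b hb|h|[b [[Bb ba] [bx hb]]]] := IH (fun b => B b /\ b <> a).
- by case: hb => /hs; rewrite inE => /predU1P[->|].
- have [[Ba ax]|na] := pselect (B a /\ a < x).
    right; exists a; split=> //; split => // b' Bb' bx.
    have [->//|ne] := pselect (b' = a).
    by case: (h b' (conj Bb' ne)).
  left=> b Bb bx; have [e|ne] := pselect (b = a); last by case: (h b (conj Bb ne)).
  by apply: na; rewrite -e.
- right; have [[Ba [ax ba']]|na] := pselect (B a /\ a < x /\ b < a).
    exists a; split => //; split => // b' Bb' bx'.
    have [->//|ne] := pselect (b' = a).
    by apply/ltW/(le_lt_trans _ ba')/hb.
  exists b; split => //; split => // b' Bb' bx'.
  have [e|ne] := pselect (b' = a); last exact: hb.
  rewrite leNgt; apply/negP => hh; apply: na.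
  by rewrite -e.
Qed.

Lemma fin_opp B : fin B -> fin (fun x => B (- x)).
Proof.
move=> [s hs]; exists [seq - x | x <- s] => x /hs h.
by rewrite -[x]opprK; apply: map_f.
Qed.

Lemma fin_min_above B x : fin B -> (forall b, B b -> ~ x < b) \/
  exists b, B b /\ x < b /\ forall b', B b' -> x < b' -> b <= b'.
Proof.
move=> /fin_opp /(fin_max_below (- x))[h|[b [Bb [bx hb]]]].
  by left=> b Bb; have := h (- b); rewrite opprK ltrN2; apply.
right; exists (- b); split => //; split; first by lra.
move=> b' Bb' xb'; have := hb (- b'); rewrite opprK ltrN2 => /(_ Bb' xb'); lra.
Qed.

(** The witness is [x] itself if it lies in [B]. Otherwise, depending on which neighbours [l] below
    and [r] above exist in [B], it is 0, [r - 1], [l + 1] or the midpoint of [l] and [r]. *)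
Lemma test_point_component B x : fin B -> exists x', test_point B x' /\
  (x' = x \/ (forall y, Num.min x x' <= y -> y <= Num.max x x' -> ~ B y)).
Proof.
move=> fB; have [Bx|nBx] := pselect (B x); first by exists x; split; left.
have key l r : (forall y, l < y -> y < r -> ~ B y) -> forall x', l < x -> x < r ->
    l < x' -> x' < r -> forall y, Num.min x x' <= y -> y <= Num.max x x' -> ~ B y.
  move=> h x' h1 h2 h3 h4 y hy1 hy2; apply: h.
    by apply: lt_le_trans hy1; rewrite lt_min h1.
  by apply: le_lt_trans hy2 _; rewrite gt_max h2.
have ne b : B b -> b <> x by move=> Bb E; apply: nBx; rewrite -E.
have [hl|[l [Bl [lx hl]]]] := fin_max_below x fB;
have [hr|[r [Br [xr hr]]]] := fin_min_above x fB.
- exists 0; split; first by right; left.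
  right=> y _ _ By; case: (ltgtP y x) => h; [exact: (hl y)|exact: (hr y)|exact: ne h].
- exists (r - 1); split; first by right; right; left; exists r; split => //; right.
  right; apply: (key (Num.min x (r - 1) - 1) r) => //; last by lra.
  + move=> y _ yr By; case: (ltgtP y x) => h; [exact: (hl y)| |exact: ne h].
    by have := hr y By h; lra.
  + have : Num.min x (r - 1) <= x by rewrite ge_min lexx.
    by lra.
  + have : Num.min x (r - 1) <= r - 1 by rewrite ge_min lexx orbT.
    by lra.
- exists (l + 1); split; first by right; right; left; exists l; split => //; left.
  right; apply: (key l (Num.max x (l + 1) + 1)) => //; try by lra.
  + move=> y yl _ By; case: (ltgtP y x) => h; [|exact: (hr y)|exact: ne h].
    by have := hl y By h; lra.
  + have : x <= Num.max x (l + 1) by rewrite le_max lexx.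
    by lra.
  + have : l + 1 <= Num.max x (l + 1) by rewrite le_max lexx orbT.
    by lra.
- exists ((l + r) / 2); split.
    by right; right; right; exists l, r; split => //; split => //; lra.
  right; apply: (key l r) => //; try by lra.
  move=> y yl yr By; case: (ltgtP y x) => h; [| |exact: ne h].
    by have := hl y By h; lra.
  by have := hr y By h; lra.
Qed.

End Rank.

Section Vpair.
Context {R : realType}.

Lemma vlast_vpair n (v : 'rV[R]_n) t : vlast (vpair v t) = t.
Proof. by rewrite /vlast mxE unlift_none. Qed.

Lemma vpairK n (x : 'rV[R]_n.+1) : vpair (butlast x) (vlast x) = x.
Proof.
by apply/rowP => i; rewrite mxE; case: unliftP => [j ->|->] //; rewrite mxE.
Qed.

Lemma vpair_lift n (v : 'rV[R]_n) t i : vpair v t ord0 (lift ord_max i) = v ord0 i.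
Proof. by rewrite mxE liftK. Qed.

Lemma vpair_max n (v : 'rV[R]_n) t : vpair v t ord0 ord_max = t.
Proof. by rewrite mxE unlift_none. Qed.
End Vpair.

(** * Uniform bounds in definable families *)

Section UniformFiniteness.
Context {R : realType} {S : forall n : nat, set (set 'rV[R]_n)}.
Hypothesis hS : o_minimal_structure S.
Local Notation ddef := (@definable R S _ _).
Local Notation dfun := (@definable_fun R S _ _ _ _).

Lemma definable_rk T (dT : Dtype R T) (P : T -> R -> Prop) k (g : T -> R) :
  ddef (fun p : T * R => P p.1 p.2) -> dfun g ->
  ddef (fun u => rk (P u) k (g u)).
Proof.
move=> hP; elim: k g => [|k IH] g hg /=; first by definability.
have h : ddef (fun p : T * R => rk (P p.1) k p.2).
  elim: k {IH g hg} => [|k IH] /=; first by definability.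
  refine (definable_ex hS _).
  have h2 := definable_comp hS (f := fun q : T * R * R => (q.1.1, q.2)) ltac:(definability) IH.
  have h3 := definable_comp hS (f := fun q : T * R * R => (q.1.1, q.2)) ltac:(definability) hP.
  by definability.
refine (definable_ex hS _).
have h2 := definable_comp hS (f := fun q : T * R => (q.1, q.2)) ltac:(definability) h.
by definability.
Qed.

Lemma definable_nth_elem T (dT : Dtype R T) (P : T -> R -> Prop) k (g : T -> R) :
  ddef (fun p : T * R => P p.1 p.2) -> dfun g ->
  ddef (fun u => nth_elem (P u) k (g u)).
Proof.
move=> hP hg; refine (definable_and hS _ (definable_and hS _ (definable_not hS _))).
- exact: (definable_comp hS (f := fun q : T => (q, g q)) ltac:(definability) hP).
- exact: definable_rk.
- exact: definable_rk.
Qed.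

Lemma definable_unstable T (dT : Dtype R T) (Y : (T * R) * R -> Prop) : ddef Y ->
  ddef (fun p : T * R => ~ stable (fun q => Y ((p.1, q.1), q.2)) p.2).
Proof. by move=> hY; rewrite /stable /matching /nearby; definability. Qed.

Lemma definable_uncovered l : ddef (fun t : R => uncovered l t).
Proof.
by elim: l => [|p l IH] /=; [definability|rewrite /nearby; definability].
Qed.

Lemma definable_slice T U (dT : Dtype R T) (dU : Dtype R U) (Y : T * U -> Prop) u :
  ddef Y -> ddef (fun t => Y (u, t)).
Proof. by move=> hY; definability. Qed.

(** Otherwise a whole interval is unstable; but the countably many conditions of
    [stable_of_loc_const] are all locally constant at some point of it. *)
Lemma fin_unstable (Y : R * R -> Prop) : ddef Y ->
  (forall s, fin (fun t => Y (s, t))) -> fin (fun s => ~ stable Y s).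
Proof.
move=> dY hf; apply: contrapT => /(infinite_itv hS)[|a [b [ab hab]]].
  have dY' : ddef (fun p : (unit * R) * R => Y (p.1.2, p.2)) by definability.
  have := definable_slice tt (definable_unstable dY').
  apply: definable_ext => s /=.
  by rewrite (_ : (fun q : R * R => Y (q.1, q.2)) = Y) //; apply/funext => -[].
pose I := (seq (rat * rat) + (rat * rat + rat * rat))%type.
pose E (i : I) (s : R) : Prop := match i with
  | inl l => exists t, Y (s, t) /\ uncovered l t
  | inr (inl p) => exists t, Y (s, t) /\ nearby (ratr p.1) (ratr p.2) t
  | inr (inr p) => exists t, exists t', t < t' /\ Y (s, t) /\ Y (s, t') /\
       nearby (ratr p.1) (ratr p.2) t /\ nearby (ratr p.1) (ratr p.2) t'
  end.
have dE i : ddef (E i).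
  case: i => [l|[p|p]]; rewrite /E /nearby.
  - by have hl := definable_uncovered l; definability.
  - by definability.
  - by definability.
have [s [h1 [h2 h3]]] := generic_point hS dE ab.
apply: (hab s h1 h2); apply: stable_of_loc_const => // [l|p|p].
- exact: (h3 (inl l)).
- exact: (h3 (inr (inl p))).
- exact: (h3 (inr (inr p))).
Qed.

(* Induction on the number of parameters: as the last one varies, the number of
   points of the fibre only changes at finitely many values, so it is enough to
   let it run through finitely many test values depending definably on the
   other parameters. *)
Lemma uniform_finiteness_row q (Y : 'rV[R]_q * R -> Prop) : ddef Y ->
  (forall u, fin (fun t => Y (u, t))) ->
  exists N, forall u, ~ has_rk (fun t => Y (u, t)) N.
Proof.
elim: q Y => [|q IH] Y dY hf.
  have [N hN] := fin_rk (hf 0); exists N => u [t [_]].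
  by rewrite (_ : u = 0) ?[u]thinmx0//; exact: hN.
pose Y' (p : ('rV[R]_q * R) * R) := Y (vpair p.1.1 p.1.2, p.2).
have dY' : ddef Y' by rewrite /Y'; definability.
pose B (p : 'rV[R]_q * R) := ~ stable (fun q => Y' ((p.1, q.1), q.2)) p.2.
have dB : ddef B := definable_unstable dY'.
have fB v : fin (fun s => B (v, s)).
  apply: (fin_unstable (Y := fun q => Y' ((v, q.1), q.2))); first by definability.
  by move=> s; exact: (hf (vpair v s)).
pose T (p : 'rV[R]_q * R) := test_point (fun s => B (p.1, s)) p.2.
have dT : ddef T by rewrite /T /test_point; definability.
have [M hM] := IH T dT (fun v => fin_test_point (fB v)).
(* The fibre of [Yj j] over [v] is that of [Y] at the [j]-th test value, so the induction hypothesis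
   bounds it; only the indices [j < M] occur. *)
pose Yj j (p : 'rV[R]_q * R) :=
  exists s, nth_elem (fun s => T (p.1, s)) j s /\ Y' ((p.1, s), p.2).
have dYj j : ddef (Yj j).
  have h1 : ddef (fun p : ('rV[R]_q * R) * R => nth_elem (fun s => T (p.1.1, s)) j p.2).
    apply: (definable_nth_elem (P := fun (p : 'rV[R]_q * R * R) s => T (p.1.1, s))).
      by clearbody T; definability.
    by definability.
  have h2 : ddef (fun p : ('rV[R]_q * R) * R => Y' ((p.1.1, p.2), p.1.2)).
    by clearbody Y'; definability.
  exact: (definable_ex hS (definable_and hS h1 h2)).
have fYj j v : fin (fun t => Yj j (v, t)).
  have [[s hs]|no] := pselect (exists s, nth_elem (fun s => T (v, s)) j s).
    apply: fin_sub (hf (vpair v s)) => t [s' [/= hs' hY]].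
    by rewrite (nth_elem_inj hs hs').
  by exists [::] => t [s [hs _]]; case: no; exists s.
have /choice[N hN] : forall j, exists N, forall v, ~ has_rk (fun t => Yj j (v, t)) N.
  by move=> j; exact: IH.
exists (\max_(j < M) N j)%N => u; rewrite -(vpairK u).
move: (butlast u) (vlast u) => v s h.
have [x [Tx hx]] := test_point_component s (fB v).
(* No unstable value lies between [s] and [x], so the cardinality condition is constant on that
   segment. *)
have {}h : has_rk (fun t => Y' ((v, x), t)) (\max_(j < M) N j)%N.
  case: hx => [->//|hx].
  have hlc y : Num.min s x <= y -> y <= Num.max s x ->
      loc_const (fun s => has_rk (fun t => Y' ((v, s), t)) (\max_(j < M) N j)%N) y.
    move=> h1 h2; have /contrapT := hx y h1 h2; rewrite /= => hst.
    exact: (stable_loc_const _ hst).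
  have := loc_const_segment hlc; rewrite /Num.min /Num.max.
  by case: ltP => hsx; [move=> /(_ (ltW hsx)) <-|move=> /(_ hsx) ->].
have [j [jM hj]] : exists j, (j < M)%N /\ nth_elem (fun s => T (v, s)) j x.
  apply: nth_elem_ex => // hr; apply: (hM v).
  by exists x.
apply: (hN j v); have [t [Yt rt]] := h; exists t; split.
  by exists x.
apply: (rk_leq (k := (\max_(j < M) N j)%N)); first exact: (leq_bigmax (Ordinal jM)).
by apply: rk_sub rt => y hy; exists x.
Qed.

Definition of_row T {dT : Dtype R T} (x : 'rV[R]_(ddim T)) : T := dec (stream x).

Lemma of_row_surj T (dT : Dtype R T) (t : T) : exists x, t = of_row x.
Proof.
exists (\row_i enc t i); rewrite -[LHS]decK; apply: dec_ext => i hi.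
by rewrite (stream_ord _ (Ordinal hi)) mxE.
Qed.

Lemma definable_fun_of_row T (dT : Dtype R T) : dfun (fun x : 'rV[R]_(ddim T) => of_row x).
Proof.
apply: (definable_fun_sub hS (f := id)) => // e; apply: dec_ext => i hi.
by rewrite (stream_ord _ (Ordinal hi)) mxE.
Qed.

(** Every coded type is the image of a row space under a definable map, from which the bound is
    inherited. *)
Lemma uniform_finiteness T (dT : Dtype R T) (Y : T * R -> Prop) : ddef Y ->
  (forall u, fin (fun t => Y (u, t))) ->
  exists N, forall u, ~ has_rk (fun t => Y (u, t)) N.
Proof.
move=> dY hf; have h := definable_fun_of_row dT.
have [| |N hN] := @uniform_finiteness_row (ddim T) (fun p => Y (of_row p.1, p.2)).
- have dg : dfun (fun p : 'rV[R]_(ddim T) * R => (of_row p.1, p.2)).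
    exact: (definable_fun_pair hS (definable_fun_comp hS h (definable_fun_proj1 hS)) (definable_fun_proj2 hS)).
  exact: (definable_comp hS dg dY).
- by move=> u; exact: (hf (of_row u)).
by exists N => u; have [x ->] := of_row_surj dT u; exact: hN.
Qed.

(* Otherwise [N + 1] consecutive subintervals would each contain a boundary
   point of the fibre, but the fibres have at most [N] boundary points. *)
Lemma uniform_subinterval T (dT : Dtype R T) (A : T * R -> Prop) (a b : R) :
  ddef A -> a < b -> exists l : seq (R * R),
    (forall J, J \in l -> a < J.1 /\ J.1 < J.2 /\ J.2 < b) /\
    forall u, exists2 J, J \in l &
      (forall t, J.1 < t -> t < J.2 -> A (u, t)) \/
      (forall t, J.1 < t -> t < J.2 -> ~ A (u, t)).
Proof.
move=> dA ab.
have [| |N hN] := @uniform_finiteness _ _ (fun p : T * R => boundary_pt (fun t => A (p.1, t)) p.2).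
- exact: definable_boundary.
- by move=> u; exact: (fin_boundary hS (definable_slice u dA)).
(* The length is cut into [2 * N + 3] equal pieces, and every second one is kept: the [N + 1] pieces
   [J i] are separated from one another and from both ends. *)
pose h := (b - a) / (2 * N + 3)%:R.
have h0 : 0 < h by rewrite divr_gt0 ?subr_gt0 ?ltr0n//; lia.
pose J i : R * R := (a + (2 * i + 1)%:R * h, a + (2 * i + 2)%:R * h).
have JS i : (J i).1 < (J i).2 by rewrite /J /= ltrD2l ltr_pM2r// ltr_nat; lia.
have Jlt i j : (i < j)%N -> (J i).2 < (J j).1.
  by move=> ij; rewrite /J /= ltrD2l ltr_pM2r// ltr_nat; lia.
exists [seq J i | i <- iota 0 N.+1]; split.
  move=> K /mapP[i]; rewrite mem_iota add0n => hi ->; split.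
    by rewrite /J /= ltrDl mulr_gt0// ltr0n; lia.
  split => //; have bE : b = a + (2 * N + 3)%:R * h.
    rewrite /h mulrCA divff ?mulr1 ?pnatr_eq0; last by lia.
    by rewrite addrC subrK.
  by rewrite [ltRHS]bE /J /= ltrD2l ltr_pM2r// ltr_nat; lia.
move=> u; apply: contrapT => hno; apply: (hN u).
have hb i : (i <= N)%N -> exists t, (J i).1 < t /\ t < (J i).2 /\
    boundary_pt (fun t => A (u, t)) t.
  move=> iN; apply: contrapT => hnb; apply: hno; exists (J i).
    by apply/mapP; exists i => //; rewrite mem_iota add0n ltnS iN.
  have hlc t : (J i).1 < t -> t < (J i).2 -> loc_const (fun t => A (u, t)) t.
    by move=> h1 h2; apply/loc_constP => h3; apply: hnb; exists t.
  pose m := ((J i).1 + (J i).2) / 2.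
  have m1 : (J i).1 < m by have := JS i; rewrite /m; lra.
  have m2 : m < (J i).2 by have := JS i; rewrite /m; lra.
  have hm t : (J i).1 < t -> t < (J i).2 -> (A (u, t) <-> A (u, m)).
    move=> t1 t2; have [tm|mt] := leP t m.
      apply: (loc_const_segment (D := fun t => A (u, t))) => // x x1 x2.
      by apply: hlc; lra.
    apply: iff_sym; apply: (loc_const_segment (D := fun t => A (u, t))) => [x x1 x2|].
      by apply: hlc; lra.
    exact: ltW.
  have [Am|nAm] := pselect (A (u, m)); [left|right] => t t1 t2.
    by apply/hm.
  by move=> /(hm t t1 t2).
(* A boundary point in [J i] has at least [i] boundary points below it; the case [i = N] contradicts
   the bound. *)
have hrk i : (i <= N)%N -> exists t, (J i).1 < t /\ t < (J i).2 /\
    boundary_pt (fun t => A (u, t)) t /\ rk (boundary_pt (fun t => A (u, t))) i t.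
  elim: i => [|i IH] hi; first by have [t [t1 [t2 t3]]] := hb 0%N hi; exists t.
  have [t [t1 [t2 t3]]] := hb i.+1 hi; have [t' [t1' [t2' [t3' t4']]]] := IH (ltnW hi).
  exists t; split => //; split => //; split => //; exists t'; split => //.
  by apply: lt_trans t2' (lt_trans (Jlt i i.+1 (ltnSn _)) t1).
by have [t [_ [_ [t3 t4]]]] := hrk N (leqnn N); exists t.
Qed.

End UniformFiniteness.

(** * Boxes *)

Section Boxes.
Context {R : realType}.

Lemma forall_ordS n (P : 'I_n.+1 -> Prop) :
  (forall i, P i) <-> (forall j, P (lift ord_max j)) /\ P ord_max.
Proof.
split=> [h|[h1 h2] i]; first by split.
by case: (unliftP ord_max i) => [j ->|->].
Qed.

Definition box n (a b x : 'rV[R]_n) : Prop :=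
  forall i, a ord0 i < x ord0 i /\ x ord0 i < b ord0 i.

Definition nonempty_box n (a b : 'rV[R]_n) : Prop := forall i, a ord0 i < b ord0 i.

(** The closure of the inner box lies in the open outer box, and the inner box is nonempty. *)
Definition inbox n (a b c d : 'rV[R]_n) : Prop :=
  forall i, a ord0 i < c ord0 i /\ c ord0 i < d ord0 i /\ d ord0 i < b ord0 i.

Lemma inbox_nonempty n (a b c d : 'rV[R]_n) : inbox a b c d -> nonempty_box c d.
Proof. by move=> h i; have [_ []] := h i. Qed.

Lemma inbox_trans n (a b c d e f : 'rV[R]_n) :
  inbox a b c d -> inbox c d e f -> inbox a b e f.
Proof.
move=> h1 h2 i; have [? [? ?]] := h1 i; have [? [? ?]] := h2 i.
by split; [|split]; lra.
Qed.

Lemma inbox_box n (a b c d x : 'rV[R]_n) : inbox a b c d -> box c d x -> box a b x.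
Proof.
move=> h1 h2 i; have [? [? ?]] := h1 i; have [? ?] := h2 i.
by split; lra.
Qed.

Definition midpoint n (a b : 'rV[R]_n) : 'rV[R]_n := 2^-1 *: (a + b).

Lemma box_midpoint n (a b : 'rV[R]_n) : nonempty_box a b -> box a b (midpoint a b).
Proof.
by move=> h i; have := h i; rewrite !mxE => hi; split; lra.
Qed.

Lemma nonempty_inbox n (a b : 'rV[R]_n) : nonempty_box a b -> exists c d, inbox a b c d.
Proof.
move=> h; exists (3^-1 *: (2 *: a + b)), (3^-1 *: (a + 2 *: b)) => i.
by have := h i; rewrite !mxE => hi; split; [|split]; lra.
Qed.

Lemma box_vpair n (a b x : 'rV[R]_n) s t y :
  box (vpair a s) (vpair b t) (vpair x y) <-> box a b x /\ s < y /\ y < t.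
Proof.
rewrite /box forall_ordS !vpair_max.
by split=> -[h1 h2]; split=> // j; have := h1 j; rewrite !vpair_lift.
Qed.

Lemma inbox_vpair n (a b c d : 'rV[R]_n) s t s' t' :
  inbox (vpair a s) (vpair b t) (vpair c s') (vpair d t') <->
  inbox a b c d /\ s < s' /\ s' < t' /\ t' < t.
Proof.
rewrite /inbox forall_ordS !vpair_max.
by split=> -[h1 h2]; split=> // j; have := h1 j; rewrite !vpair_lift.
Qed.

Lemma nonempty_box_vpair n (a b : 'rV[R]_n) s t :
  nonempty_box (vpair a s) (vpair b t) <-> nonempty_box a b /\ s < t.
Proof.
rewrite /nonempty_box forall_ordS !vpair_max.
by split=> -[h1 h2]; split=> // j; have := h1 j; rewrite !vpair_lift.
Qed.

Definition box_loc_const n (D : 'rV[R]_n -> Prop) x : Prop :=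
  exists c d, box c d x /\ forall y, box c d y -> (D y <-> D x).

End Boxes.

(** * Baire property and uniform subboxes in several variables *)

Section BoxBaire.
Context {R : realType} {S : forall n : nat, set (set 'rV[R]_n)}.
Hypothesis hS : o_minimal_structure S.
Local Notation ddef := (@definable R S _ _).
Local Notation dfun := (@definable_fun R S _ _ _ _).

(** Over each base point, [Baire1] puts an interval of the last coordinate into some [E i]. With
    rational ends, these intervals yield a countable cover of the base box, to which the induction
    hypothesis applies. *)
Lemma Baire_box n (I : countType) (E : I -> 'rV[R]_n -> Prop) (a b : 'rV[R]_n) :
  (forall i, ddef (E i)) -> nonempty_box a b ->
  (forall x, box a b x -> exists i, E i x) ->
  exists i c d, inbox a b c d /\ forall x, box c d x -> E i x.
Proof.
elim: n I E a b => [|n IH] I E a b dE ab cov.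
  have [[] //|i hi] := cov 0; exists i, 0, 0; split; first by case.
  by move=> x _; rewrite (thinmx0 x).
move: ab cov; rewrite -(vpairK a) -(vpairK b).
move: (butlast a) (vlast a) (butlast b) (vlast b) => {a}a s {b}b t.
move=> /nonempty_box_vpair[ab st] cov.
pose E' (k : I * (rat * rat)) (x : 'rV[R]_n) := s < ratr k.2.1 /\
  ratr k.2.1 < ratr k.2.2 :> R /\ ratr k.2.2 < t /\
  forall y, ratr k.2.1 < y -> y < ratr k.2.2 -> E k.1 (vpair x y).
have dE' k : ddef (E' k) by rewrite /E'; have := dE k.1 => ?; definability.
have [x hx|[i [q1 q2]] [c [d [cd hE]]]] := IH _ E' a b dE' ab.
  have [i|y sy yt|i [c [d [sc [cd [dt h]]]]]] :=
    Baire1 hS (E := fun i y => E i (vpair x y)) _ st.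
  - by have := dE i => ?; definability.
  - by apply: cov; apply/box_vpair.
  have [q1 [h1 h2]] := rat_between cd; have [q2 [h3 h4]] := rat_between h2.
  exists (i, (q1, q2)); rewrite /E' /=; split; first by lra.
  split => //; split; first by lra.
  by move=> y h5 h6; apply: h; lra.
have [h1 [h2 [h3 _]]] := hE _ (box_midpoint (inbox_nonempty cd)).
exists i, (vpair c (ratr q1)), (vpair d (ratr q2)); split.
  by apply/inbox_vpair.
move=> x; rewrite -(vpairK x) => /box_vpair[hx [h4 h5]].
by have [_ [_ [_ h]]] := hE _ hx; exact: h.
Qed.

Lemma box_dichotomy n (D : 'rV[R]_n -> Prop) (a b : 'rV[R]_n) :
  ddef D -> nonempty_box a b -> exists c d, inbox a b c d /\
    ((forall x, box c d x -> D x) \/ (forall x, box c d x -> ~ D x)).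
Proof.
move=> dD ab.
have [i|x _|i [c [d [cd h]]]] :=
  Baire_box (E := fun (i : bool) x => if i then D x else ~ D x) _ ab.
- by case: i => //; definability.
- by have [?|?] := pselect (D x); [exists true|exists false].
by exists c, d; split => //; case: i h; [left|right].
Qed.

Lemma definable_box_loc_const n T (dT : Dtype R T) (D : T -> 'rV[R]_n -> Prop) (f : T -> 'rV[R]_n) :
  ddef (fun p : T * 'rV[R]_n => D p.1 p.2) -> dfun f ->
  ddef (fun t => box_loc_const (D t) (f t)).
Proof.
by move=> hD hf; rewrite /box_loc_const /box; definability.
Qed.

(** Every box has a subbox on which [E i] is constant, so the points where [E i] is not locally
    constant fill no box; countably many such sets cannot cover one. *)
Lemma generic_point_box n (I : countType) (E : I -> 'rV[R]_n -> Prop) a b :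
  (forall i, ddef (E i)) -> nonempty_box a b ->
  exists x, box a b x /\ forall i, box_loc_const (E i) x.
Proof.
move=> dE ab; apply: contrapT => hno.
have [i|x hx|i [c [d [cd h]]]] := Baire_box (E := fun i x => ~ box_loc_const (E i) x) _ ab.
- refine (definable_not hS (definable_box_loc_const (D := fun=> E i) _ (definable_fun_id hS))).
  by have := dE i => ?; definability.
- apply: contrapT => h3; apply: hno; exists x; split => // i.
  by apply: contrapT => h4; apply: h3; exists i.
have [e [f [ef hE]]] := box_dichotomy (dE i) (inbox_nonempty cd).
have hc := box_midpoint (inbox_nonempty ef).
apply: (h (midpoint e f)); first exact: inbox_box ef hc.
exists e, f; split => // y hy.
by case: hE => hE; split=> // h1; have := hE _ hy; have := hE _ hc.
Qed.

Definition uniform_on n T (A : T * 'rV[R]_n -> Prop) u (c d : 'rV[R]_n) : Prop :=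
  (forall x, box c d x -> A (u, x)) \/ (forall x, box c d x -> ~ A (u, x)).

Lemma uniform_on_inbox n T (A : T * 'rV[R]_n -> Prop) u c d e f :
  inbox c d e f -> uniform_on A u c d -> uniform_on A u e f.
Proof. by move=> hi [h|h]; [left|right] => x /(inbox_box hi)/h. Qed.

(** The case of one family is isolated because the induction on the dimension uses its consequence
    for finitely many families. *)
Definition uniform_single n : Prop :=
  forall T (dT : Dtype R T) (A : T * 'rV[R]_n -> Prop) (a b : 'rV[R]_n),
  ddef A -> nonempty_box a b -> exists l : seq ('rV[R]_n * 'rV[R]_n),
    (forall Q, Q \in l -> inbox a b Q.1 Q.2) /\
    forall u, exists2 Q, Q \in l & uniform_on A u Q.1 Q.2.

(** The families are treated one after the other, each time subdividing every box obtained so far;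
    uniformity passes to subboxes. *)
Lemma uniform_family_of_single n : uniform_single n ->
  forall T (dT : Dtype R T) (I : eqType) (s : seq I)
    (A : I -> T * 'rV[R]_n -> Prop) (a b : 'rV[R]_n),
  (forall i, ddef (A i)) -> nonempty_box a b ->
  exists l : seq ('rV[R]_n * 'rV[R]_n),
    (forall Q, Q \in l -> inbox a b Q.1 Q.2) /\
    forall u, exists2 Q, Q \in l & forall i, i \in s -> uniform_on (A i) u Q.1 Q.2.
Proof.
move=> H T dT I s A a b dA ab; elim: s => [|i s [l [hl hu]]].
  have [c [d cd]] := nonempty_inbox ab; exists [:: (c, d)]; split.
    by move=> Q; rewrite inE => /eqP ->.
  by move=> u; exists (c, d) => //; rewrite inE.
have /choice[F hF] : forall Q : 'rV[R]_n * 'rV[R]_n, exists l : seq ('rV[R]_n * 'rV[R]_n),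
   nonempty_box Q.1 Q.2 -> (forall Q', Q' \in l -> inbox Q.1 Q.2 Q'.1 Q'.2) /\
    forall u, exists2 Q', Q' \in l & uniform_on (A i) u Q'.1 Q'.2.
  move=> Q; have [h|h] := pselect (nonempty_box Q.1 Q.2); last by exists [::].
  by have [l' hl'] := H _ _ _ _ _ (dA i) h; exists l'.
exists (flatten [seq F Q | Q <- l]); split.
  move=> Q' /flattenP[_ /mapP[Q hQ ->] hQ']; have h := hl Q hQ.
  by have [h1 _] := hF Q (inbox_nonempty h); apply: inbox_trans h (h1 _ hQ').
move=> u; have [Q hQ hs] := hu u; have h := hl Q hQ.
have [h1 /(_ u)[Q' hQ' hA]] := hF Q (inbox_nonempty h); exists Q'.
  by apply/flattenP; exists (F Q) => //; apply: map_f.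
move=> j; rewrite inE => /predU1P[->//|/hs]; apply: uniform_on_inbox.
exact: h1.
Qed.

(** The intervals [Js] of the last coordinate serve all pairs of a parameter and a base point.
    Containing or missing one of them is then a definable family over the base. *)
Lemma uniform_single_holds n : uniform_single n.
Proof.
elim: n => [|n IH] T dT A a b dA ab.
  exists [:: (0, 0)]; split; first by move=> Q _ [].
  move=> u; exists (0, 0); rewrite ?inE //.
  by have [h|h] := pselect (A (u, 0)); [left|right] => x _; rewrite (thinmx0 x).
move: ab; rewrite -(vpairK a) -(vpairK b).
move: (butlast a) (vlast a) (butlast b) (vlast b) => {a}a s {b}b t.
move=> /nonempty_box_vpair[ab st].
have [|Js [hJ1 hJ2]] := uniform_subinterval hS
   (A := fun p : (T * 'rV[R]_n) * R => A (p.1.1, vpair p.1.2 p.2)) _ st.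
  by definability.
pose E (k : (R * R) * bool) (p : T * 'rV[R]_n) : Prop :=
  forall y, k.1.1 < y -> y < k.1.2 ->
    if k.2 then A (p.1, vpair p.2 y) else ~ A (p.1, vpair p.2 y).
have dE k : ddef (E k) by case: k => J []; rewrite /E; definability.
have [l [hl hu]] := uniform_family_of_single IH
  [seq (J, k) | J <- Js, k <- [:: true; false]] dE ab.
exists [seq (vpair Q.1 J.1, vpair Q.2 J.2) | Q <- l, J <- Js]; split.
  move=> Q' /allpairsP[[Q J]] /= [hQ hJ ->] /=; apply/inbox_vpair.
  by split; [exact: hl|exact: hJ1].
move=> u; have [Q hQ hE] := hu u.
have hc := box_midpoint (inbox_nonempty (hl Q hQ)).
(* The interval that works over the midpoint works over all of [Q], as [E (J, k)] is uniform
   there. *)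
have [J hJ hA] := hJ2 (u, midpoint Q.1 Q.2).
have [k hk] : exists k, E (J, k) (u, midpoint Q.1 Q.2).
  by case: hA => h; [exists true|exists false] => y h1 h2; exact: h.
have hin : (J, k) \in [seq (J, k) | J <- Js, k <- [:: true; false]].
  by apply: allpairs_f => //; case: k {hk}.
have {hin} hQE : forall x, box Q.1 Q.2 x -> E (J, k) (u, x).
  by have [//|h] := hE _ hin; have := h _ hc.
exists (vpair Q.1 J.1, vpair Q.2 J.2); first exact: allpairs_f.
by case: k {hk} hQE => hQE; [left|right] => x; rewrite -(vpairK x) =>
  /box_vpair[hx [h4 h5]]; have := hQE _ hx _ h4 h5.
Qed.

Definition uniform_family n := uniform_family_of_single (@uniform_single_holds n).

End BoxBaire.

(** * Generic smoothness *)

Section Slopes.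
Context {R : realType}.
Implicit Types (g : R -> R) (x r : R).

(** In the four names the first letter is the side, right or left, and the second tells whether the
    difference quotients near [x] are less or greater than [r]. *)
Definition slopeRL g x r := exists e, 0 < e /\ forall h, 0 < h -> h < e ->
  g (x + h) - g x < r * h.
Definition slopeRG g x r := exists e, 0 < e /\ forall h, 0 < h -> h < e ->
  r * h < g (x + h) - g x.
Definition slopeLL g x r := exists e, 0 < e /\ forall h, 0 < h -> h < e ->
  g x - g (x - h) < r * h.
Definition slopeLG g x r := exists e, 0 < e /\ forall h, 0 < h -> h < e ->
  r * h < g x - g (x - h).

Lemma slopeRLN g x r : slopeRL (fun y => - g y) x r <-> slopeRG g x (- r).
Proof.
by split=> -[e [e0 h]]; exists e; split => // y y0 ye; have := h y y0 ye; lra.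
Qed.
Lemma slopeLGN g x r : slopeLG (fun y => - g y) x r <-> slopeLL g x (- r).
Proof.
by split=> -[e [e0 h]]; exists e; split => // y y0 ye; have := h y y0 ye; lra.
Qed.
Lemma slopeRGN g x r : slopeRG (fun y => - g y) x r <-> slopeRL g x (- r).
Proof.
by split=> -[e [e0 h]]; exists e; split => // y y0 ye; have := h y y0 ye; lra.
Qed.

End Slopes.

Section Differentiability.
Context {R : realType} {S : forall n : nat, set (set 'rV[R]_n)}.
Hypothesis hS : o_minimal_structure S.
Local Notation ddef := (@definable R S _ _).
Local Notation dfun := (@definable_fun R S _ _ _ _).
Implicit Types (g : R -> R) (x r : R).

(** The boundary is finite, so a short interval to the right of [x] avoids it. *)
Lemma germ_right (D : R -> Prop) x : ddef D -> exists e, 0 < e /\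
  ((forall h, 0 < h -> h < e -> D (x + h)) \/
   (forall h, 0 < h -> h < e -> ~ D (x + h))).
Proof.
move=> dD; have [s hs] := fin_boundary hS dD.
have [|y _|e [e0 he]] := @seq_common_radius R _ s (fun y e => ~ (x < y /\ y < x + e)).
- by move=> y e e' h _ le [h1 h2]; apply: h; split => //; lra.
- have [h|h] := ltP x y; last by exists 1; split => // -[? _]; lra.
  by exists (y - x); split; [lra|move=> [_]; lra].
exists e; split=> //.
have hlc h : 0 < h -> h < e -> (D (x + h) <-> D (x + e / 2)).
  move=> h0 h1.
  have hl y : x < y -> y < x + e -> loc_const D y.
    by move=> h2 h3; apply/loc_constP => /hs/he; apply; split; lra.
  have [le|le] := leP h (e / 2).
    apply: loc_const_segment => [y y1 y2|]; last by lra.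
    by apply: hl; lra.
  apply: iff_sym; apply: loc_const_segment => [y y1 y2|]; last by lra.
  by apply: hl; lra.
have [hD|hD] := pselect (D (x + e / 2)); [left|right] => h h0 h1.
  exact/hlc.
by move=> /(hlc h h0 h1).
Qed.

Lemma slopeR_total g x r : dfun g -> slopeRL g x r \/
  exists e, 0 < e /\ forall h, 0 < h -> h < e -> r * h <= g (x + h) - g x.
Proof.
move=> dg; have dD : ddef (fun y => g y - g x < r * (y - x)) by definability.
have [e [e0 [h|h]]] := germ_right x dD; [left|right]; exists e; split=> // y y0 ye.
  by have := h y y0 ye; rewrite (addrC x y) addrK.
by have := h y y0 ye; rewrite (addrC x y) addrK leNgt => /negP.
Qed.

Lemma slopeR_total' g x r : dfun g -> slopeRG g x r \/
  exists e, 0 < e /\ forall h, 0 < h -> h < e -> g (x + h) - g x <= r * h.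
Proof.
move=> dg; have dg' : dfun (fun y => - g y) by definability.
have [/slopeRLN|[e [e0 h]]] := slopeR_total x (- r) dg'.
  by rewrite opprK; left.
by right; exists e; split => // y y0 ye; have := h y y0 ye; lra.
Qed.

Lemma slopeL_total g x r : dfun g -> slopeLL g x r \/
  exists e, 0 < e /\ forall h, 0 < h -> h < e -> r * h <= g x - g (x - h).
Proof.
move=> dg; have dg' : dfun (fun y => - g (- y)) by definability.
have [[e [e0 h]]|[e [e0 h]]] := slopeR_total (- x) r dg'; [left|right];
  exists e; split => // y y0 ye; have := h y y0 ye; rewrite opprD !opprK; lra.
Qed.

Lemma slopeL_total' g x r : dfun g -> slopeLG g x r \/
  exists e, 0 < e /\ forall h, 0 < h -> h < e -> g x - g (x - h) <= r * h.
Proof.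
move=> dg; have dg' : dfun (fun y => - g (- y)) by definability.
have [[e [e0 h]]|[e [e0 h]]] := slopeR_total' (- x) r dg'; [left|right];
  exists e; split => // y y0 ye; have := h y y0 ye; rewrite opprD !opprK; lra.
Qed.

(* A common rational slope and a common radius on a subinterval make any two of
   its points that are close contradict each other. *)
Lemma no_concave_corners g (a b : R) : dfun g -> a < b ->
  ~ (forall x, a < x -> x < b -> exists r1, exists r2, r1 < r2 /\
       slopeRL g x r1 /\ slopeLG g x r2).
Proof.
move=> dg ab hA.
pose E (k : rat * rat) x := 0 < ratr k.2 :> R /\ forall h, 0 < h -> h < ratr k.2 ->
  g (x + h) - g x < ratr k.1 * h /\ ratr k.1 * h < g x - g (x - h).
have dE k : ddef (E k) by rewrite /E; definability.
have [x xa xb|[q n] [c [d [ac [cd [db h]]]]]] := Baire1 hS dE ab.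
  have [r1 [r2 [r12 [[e1 [e10 h1]] [e2 [e20 h2]]]]]] := hA x xa xb.
  have [q [q1 q2]] := rat_between r12.
  have e0 : 0 < Num.min e1 e2 by rewrite lt_min e10.
  have [n [n0 n1]] := rat_between e0; exists (q, n); split=> //= y y0 yn.
  have := lt_trans yn n1; rewrite lt_min => /andP[y1 y2]; split.
    by apply: lt_trans (h1 y y0 y1) _; rewrite ltr_pM2r.
  by apply: lt_trans (h2 y y0 y2); rewrite ltr_pM2r.
pose x := (c + d) / 2; have cx : c < x by rewrite /x; lra.
have xd : x < d by rewrite /x; lra.
have [n0 hx] := h x cx xd; rewrite /= in n0 hx.
pose k := Num.min (ratr n) (d - x) / 2.
have m0 : 0 < Num.min (ratr n) (d - x) by rewrite lt_min n0 subr_gt0.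
have k1 : k < ratr n.
  have : Num.min (ratr n) (d - x) <= ratr n by rewrite ge_min lexx.
  by rewrite /k; lra.
have k2 : k < d - x.
  have : Num.min (ratr n) (d - x) <= d - x by rewrite ge_min lexx orbT.
  by rewrite /k; lra.
have k0 : 0 < k by rewrite /k; lra.
have [h1 _] := hx k k0 k1.
have [_ /(_ k k0 k1)[_]] := h (x + k) ltac:(lra) ltac:(lra).
by rewrite addrK /=; lra.
Qed.

Lemma no_convex_corners g (a b : R) : dfun g -> a < b ->
  ~ (forall x, a < x -> x < b -> exists r1, exists r2, r1 < r2 /\
       slopeLL g x r1 /\ slopeRG g x r2).
Proof.
move=> dg ab h; have dg' : dfun (fun y => - g y) by definability.
apply: (no_concave_corners dg' ab) => x xa xb.
have [r1 [r2 [r12 [h1 h2]]]] := h x xa xb; exists (- r2), (- r1).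
rewrite ltrN2; split => //; split; first by apply/slopeRLN; rewrite opprK.
by apply/slopeLGN; rewrite opprK.
Qed.

(* The function increases on a subinterval; there, the set of points of the
   graph above a steep chord through the left end is closed under suprema. *)
Lemma no_vertical_slopes g (a b : R) : dfun g -> a < b ->
  ~ (forall x, a < x -> x < b -> forall r, slopeRG g x r).
Proof.
move=> dg ab hP.
pose E (k : rat) x := 0 < ratr k :> R /\ forall h, 0 < h -> h < ratr k ->
  g x < g (x + h).
have dE k : ddef (E k) by rewrite /E; definability.
have [x xa xb|n [c [d [ac [cd [db h]]]]]] := Baire1 hS dE ab.
  have [e [e0 h1]] := hP x xa xb 0.
  have [n [n0 n1]] := rat_between e0; exists n; split=> //= y y0 yn.
  by have := h1 y y0 (lt_trans yn n1); lra.
pose x := (c + d) / 2; have cx : c < x by rewrite /x; lra.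
have xd : x < d by rewrite /x; lra.
have [n0 _] := h x cx xd.
pose k := Num.min (ratr n) (d - x) / 2.
have m0 : 0 < Num.min (ratr n) (d - x) by rewrite lt_min n0 subr_gt0.
have k1 : k < ratr n.
  have : Num.min (ratr n) (d - x) <= ratr n by rewrite ge_min lexx.
  by rewrite /k; lra.
have k2 : k < d - x.
  have : Num.min (ratr n) (d - x) <= d - x by rewrite ge_min lexx orbT.
  by rewrite /k; lra.
have k0 : 0 < k by rewrite /k; lra.
(* A slope steeper than that of the chord from [x] to [x + k], which keeps [k] out of [Z]. *)
pose r := (g (x + k) - g x) / k + 1.
have hr : g (x + k) - g x < r * k.
  by rewrite /r mulrDl divfK ?mul1r ?ltrDl // gt_eqF.
pose Z := [set y | 0 <= y /\ y <= k /\ r * y <= g (x + y) - g x].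
have Z0 : Z 0 by rewrite /Z /= lexx (ltW k0) addr0 mulr0 subrr.
have hZ : has_sup Z by split; [exists 0|exists k => y [_ []]].
have s0 : 0 <= sup Z by apply: sup_upper_bound.
have sk : sup Z <= k by apply: ge_sup; [exists 0|move=> y [_ []]].
have mono y : 0 <= y -> y < sup Z -> g (x + y) <= g (x + sup Z).
  move=> y0 ys; have [_ /(_ (sup Z - y))] := h (x + y) ltac:(lra) ltac:(lra).
  have -> : x + y + (sup Z - y) = x + sup Z by ring.
  by move=> H; apply: ltW; apply: H; lra.
(* If this failed by [e], an element of [Z] closer to the supremum than [e / (|r| + 1)] would
   contradict monotonicity. *)
have Zs : r * sup Z <= g (x + sup Z) - g x.
  rewrite leNgt; apply/negP => hlt.
  pose e := (r * sup Z - (g (x + sup Z) - g x)).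
  have e0 : 0 < e by rewrite /e; lra.
  pose e' := e / (`|r| + 1).
  have r0 : 0 < `|r| + 1 by rewrite ltr_wpDl.
  have e'0 : 0 < e' by rewrite divr_gt0.
  have [y [y0 [yk hy]] ye] := sup_adherent e'0 hZ.
  have ys : y <= sup Z by apply: sup_upper_bound.
  have gy : g (x + y) <= g (x + sup Z).
    by move: ys; rewrite le_eqVlt => /predU1P[->//|]; exact: mono.
  have : r * (sup Z - y) < e.
    apply: le_lt_trans (_ : (`|r| + 1) * (sup Z - y) < e).
      apply: ler_wpM2r; first by lra.
      by have := ler_norm r; lra.
    by rewrite mulrC -ltr_pdivlMr// -/e'; lra.
  by rewrite mulrBr /e; lra.
have sk' : sup Z < k.
  rewrite lt_neqAle sk andbT; apply/eqP => E1; move: Zs; rewrite E1; lra.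
have [e [e0 he]] := hP (x + sup Z) ltac:(lra) ltac:(lra) r.
pose t := Num.min e (k - sup Z) / 2.
have t0' : 0 < Num.min e (k - sup Z) by rewrite lt_min e0 subr_gt0.
have t1 : t < e.
  have : Num.min e (k - sup Z) <= e by rewrite ge_min lexx.
  by rewrite /t; lra.
have t2 : t < k - sup Z.
  have : Num.min e (k - sup Z) <= k - sup Z by rewrite ge_min lexx orbT.
  by rewrite /t; lra.
have t0 : 0 < t by rewrite /t; lra.
have : sup Z + t <= sup Z.
  apply: sup_upper_bound => //; split; first by lra.
  split; first by lra.
  by have := he t t0 t1; rewrite mulrDr addrA; lra.
by lra.
Qed.

(** Differentiability with derivative [s], without quotients or limits, so that it is a first-order
    formula. *)
Definition deriv_at g x s := forall e, 0 < e -> exists d, 0 < d /\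
  forall h, - d < h -> h < d -> `|g (x + h) - g x - s * h| <= e * `|h|.

(** Nondifferentiability has four causes: a concave or convex corner, or an infinite right
    derivative of either sign. None of them can persist on an interval, so all are absent at a
    generic point. *)
Lemma derivative_exists g (a b : R) : dfun g -> a < b ->
  exists x, a < x /\ x < b /\ exists s, deriv_at g x s.
Proof.
move=> dg ab.
pose E (k : bool + bool) x := match k with
  | inl true => exists r1, exists r2, r1 < r2 /\ slopeRL g x r1 /\ slopeLG g x r2
  | inl false => exists r1, exists r2, r1 < r2 /\ slopeLL g x r1 /\ slopeRG g x r2
  | inr true => forall r, slopeRG g x r
  | inr false => forall r, slopeRL g x r end.
have dE k : ddef (E k).
  by case: k => -[]; rewrite /E /slopeRL /slopeLG /slopeLL /slopeRG; definability.
have [x [ax [xb hE]]] := generic_point hS dE ab.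
exists x; split => //; split => //.
have nE k : ~ E k x.
  move=> Ek; have [e [e0 he]] := hE k.
  have hE' y : x - e < y -> y < x + e -> E k y by move=> h1 h2; apply/he.
  have lt : x - e < x + e by lra.
  case: k {he Ek} hE' => -[] h.
  - exact: (no_concave_corners dg lt h).
  - exact: (no_convex_corners dg lt h).
  - exact: (no_vertical_slopes dg lt h).
  - have dg' : dfun (fun y => - g y) by definability.
    by apply: (no_vertical_slopes dg' lt) => y y1 y2 r; apply/slopeRGN/h.
have [r1 nr1] : exists r, ~ slopeRG g x r by apply/existsNP; exact: (nE (inr true)).
have [r2 nr2] : exists r, ~ slopeRL g x r by apply/existsNP; exact: (nE (inr false)).
have [//|[e1 [e10 h1]]] := slopeR_total' x r1 dg.
have [//|[e2 [e20 h2]]] := slopeR_total x r2 dg.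
pose Q := [set r | slopeRL g x r].
have monoQ r r' : r < r' -> (exists e, 0 < e /\ forall h, 0 < h -> h < e ->
    g (x + h) - g x <= r * h) -> Q r'.
  move=> rr [e [e0 he]]; exists e; split => // h h0 h3.
  by apply: le_lt_trans (he h h0 h3) _; rewrite ltr_pM2r.
have Qle r r' : r < r' -> Q r -> Q r'.
  move=> rr [e [e0 he]]; apply: (monoQ _ _ rr); exists e; split => // h h0 h3.
  exact/ltW/he.
have hQ : has_inf Q.
  split; first by exists (r1 + 1); apply: (monoQ r1); [lra|exists e1].
  exists r2 => r Qr; rewrite leNgt; apply/negP => /Qle/(_ Qr).
  by move=> q; apply: nr2.
(* The right derivative; the infimum is finite because infinite slopes are excluded. *)
pose s := inf Q.
have sQ e : 0 < e -> Q (s + e).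
  move=> e0; have [r Qr rs] := inf_adherent e0 hQ.
  exact: Qle rs Qr.
have snQ e : 0 < e -> ~ Q (s - e).
  move=> e0 q; have : inf Q <= s - e by apply: ge_inf => //; case: hQ.
  by rewrite -/s; lra.
exists s => e0 e0p.
(* The right quotients lie within [e] of [s]. Left quotients above [s + 2 * e] or below [s - 3 * e]
   would form a corner with them; the margins provide the strict inequality between the two
   slopes. *)
pose e := e0 / 3; have ep : 0 < e by rewrite /e; lra.
have [f1 [f10 g1]] := sQ e ep.
have [/(snQ e ep)//|[f2 [f20 g2]]] := slopeR_total x (s - e) dg.
have [hh|[f3 [f30 g3]]] := slopeL_total' x (s + 2 * e) dg.
  case: (nE (inl true)); exists (s + e), (s + 2 * e); split; first by lra.
  by split => //; exact: sQ.
have [hh|[f4 [f40 g4]]] := slopeL_total x (s - 3 * e) dg.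
  case: (nE (inl false)); exists (s - 3 * e), (s - 2 * e); split; first by lra.
  split => //; exists f2; split => // h h0 hf.
  by apply: lt_le_trans (g2 h h0 hf); rewrite ltr_pM2r//; lra.
exists (Num.min (Num.min f1 f2) (Num.min f3 f4)); split.
  by rewrite !lt_min f10 f20 f30 f40.
move=> h; rewrite ltrNl !lt_min.
move=> /andP[/andP[m1 m2] /andP[m3 m4]] /andP[/andP[p1 p2] /andP[p3 p4]].
have ee : e0 = 3 * e by rewrite /e; lra.
rewrite ee; case: (ltgtP h 0) => [h0|h0|->]; last first.
- by rewrite addr0 subrr mulr0 subrr !normr0 mulr0.
- rewrite (gtr0_norm h0) ler_norml.
  have := g1 h h0 p1; have := g2 h h0 p2.
  have eh : 0 < e * h by rewrite mulr_gt0.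
  rewrite !mulrDl !mulNr => u1 u2; rewrite -mulrA; apply/andP; split; lra.
- have [k hk] : exists k, h = - k by exists (- h); rewrite opprK.
  subst h; have k0 : 0 < k by lra.
  rewrite normrN (gtr0_norm k0) ler_norml; rewrite opprK in m3 m4.
  have := g3 k k0 m3; have := g4 k k0 m4.
  have ek : 0 < e * k by rewrite mulr_gt0.
  by move=> u1 u2; apply/andP; split; lra.
Qed.

End Differentiability.

(** * Continuity and derivatives in several variables *)

Section Regularity.
Context {R : realType}.

Lemma box_nbhs n (c d x : 'rV[R]_n) : box c d x -> nbhs x (box c d).
Proof.
move=> h; have [| |e [e0 he]] := @seq_common_radius R _ (enum 'I_n)
    (fun i e => c ord0 i <= x ord0 i - e /\ x ord0 i + e <= d ord0 i).
- by move=> i e e' [h1 h2] _ le; split; lra.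
- move=> i _; have [h1 h2] := h i.
  exists (Num.min (x ord0 i - c ord0 i) (d ord0 i - x ord0 i)).
  rewrite lt_min !subr_gt0 h1 h2; split => //.
  have : Num.min (x ord0 i - c ord0 i) (d ord0 i - x ord0 i) <= x ord0 i - c ord0 i.
    by rewrite ge_min lexx.
  have : Num.min (x ord0 i - c ord0 i) (d ord0 i - x ord0 i) <= d ord0 i - x ord0 i.
    by rewrite ge_min lexx orbT.
  by move=> *; split; lra.
apply/nbhs_ballP; exists e => //= y [_ hy] i.
have := hy ord0 i; rewrite /ball /= ltr_distlC => /andP[h1 h2].
have [h3 h4] := he i (mem_enum _ _).
by split; lra.
Qed.

Definition cont_at n (f : 'rV[R]_n -> R) x : Prop :=
  forall e, 0 < e -> exists c, exists d, box c d x /\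
    forall y, box c d y -> nearby (f x) e (f y).

Lemma cont_at_continuous n (f : 'rV[R]_n -> R) x :
  cont_at f x -> {for x, continuous f}.
Proof.
move=> h; have F : Filter (nbhs x) by exact: nbhs_filter.
apply/(@cvgrPdist_lt _ _ _ (nbhs x) F) => e e0.
have [c [d [hx hcd]]] := h e e0.
apply: (@filterS _ (nbhs x) _ (box c d)); last exact: box_nbhs.
move=> y /hcd[h1 h2].
by rewrite ltr_distlC; apply/andP; split; lra.
Qed.

Lemma derive_cvgP (V : normedModType R) (f : V -> R) (x v : V) s :
  (fun h : R => h^-1 *: ((f \o shift x) (h *: v) - f x)) @ 0^' --> s <->
  deriv_at (fun h => f (h *: v + x)) 0 s.
Proof.
split=> [/cvgrPdist_le h e e0|h].
  have /nbhs_ballP[d /= d0 hd] := h e e0; exists d; split => // y y1 y2.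
  have [->|y0] := eqVneq y 0; first by rewrite addr0 subrr mulr0 subrr !normr0 mulr0.
  have /hd/(_ y0) : ball (0 : R) d y.
    by rewrite /ball /= sub0r normrN ltr_norml y1 y2.
  move=> hy; have {}hy : `|s - y^-1 * (f (y *: v + x) - f x)| <= e := hy.
  rewrite add0r scale0r add0r.
  have -> : f (y *: v + x) - f x - s * y = - (s - y^-1 * (f (y *: v + x) - f x)) * y.
    by rewrite opprB mulrBl mulrAC mulVf // mul1r.
  by rewrite normrM normrN ler_wpM2r.
apply/cvgrPdist_le => e e0; have [d [d0 hd]] := h e e0.
apply/nbhs_ballP; exists d => //= y; rewrite /ball /= sub0r normrN ltr_norml.
move=> /andP[y1 y2] y0; have := hd y y1 y2; rewrite add0r scale0r add0r.
rewrite -[X in _ -> X]/(is_true (`|s - y^-1 * (f (y *: v + x) - f x)| <= e)).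
have -> : f (y *: v + x) - f x - s * y = - (s - y^-1 * (f (y *: v + x) - f x)) * y.
  by rewrite opprB mulrBl mulrAC mulVf // mul1r.
by rewrite normrM normrN ler_pM2r // normr_gt0.
Qed.

Lemma deriv_at_derivable (V : normedModType R) (f : V -> R) (x v : V) s :
  deriv_at (fun h => f (h *: v + x)) 0 s -> derivable f x v.
Proof. by move=> /derive_cvgP h; apply/cvg_ex; exists s. Qed.

Lemma deriv_at_derive (V : normedModType R) (f : V -> R) (x v : V) s :
  deriv_at (fun h => f (h *: v + x)) 0 s -> 'D_v f x = s.
Proof. by move=> /derive_cvgP h; apply: cvg_lim. Qed.

(** The default value [point] makes the partial derivative a total function, whose graph is shown
    definable in [definable_fun_derive]. *)
Lemma not_deriv_at_derive (V : normedModType R) (f : V -> R) (x v : V) :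
  ~ (exists s, deriv_at (fun h => f (h *: v + x)) 0 s) -> 'D_v f x = point.
Proof.
move=> h; apply: dvgP => /cvg_ex[s hs]; apply: h; exists s.
exact/derive_cvgP.
Qed.

(* At every point of an open set, this says that [f] is C^k. *)
Fixpoint Ck_at n k (f : 'rV[R]_n -> R) x : Prop :=
  cont_at f x /\ if k is k'.+1 then forall i : 'I_n,
    (exists s, deriv_at (fun h => f (h *: delta_mx ord0 i + x)) 0 s) /\
    Ck_at k' (fun x => 'D_(delta_mx ord0 i) f x) x
  else True.

Lemma Ck_at_is_Cp n k (U : set 'rV[R]_n) f :
  (forall x, U x -> Ck_at k f x) -> is_Cp k U f.
Proof.
elim: k f => [|k IH] f h; split=> //.
- by move=> x /h[/cont_at_continuous].
- by move=> x /h[/cont_at_continuous].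
- move=> i; split=> [x /h[_ /(_ i)[[s hs] _]]|].
    exact: deriv_at_derivable hs.
  by apply: IH => x /h[_ /(_ i)[]].
Qed.

(** For definable [D] this follows from density, by [box_generic_of_dense]; in this form it is
    stable under finite conjunctions. *)
Definition box_generic n (D : 'rV[R]_n -> Prop) : Prop := forall a b, nonempty_box a b ->
  exists c d, inbox a b c d /\ forall x, box c d x -> D x.

Lemma box_generic_and n (D E : 'rV[R]_n -> Prop) : box_generic D -> box_generic E ->
  box_generic (fun x => D x /\ E x).
Proof.
move=> hD hE a b /hD[c [d [cd h]]]; have [e [f [ef h']]] := hE _ _ (inbox_nonempty cd).
exists e, f; split; first exact: inbox_trans ef.
by move=> x hx; split; [apply/h/(inbox_box ef)|exact: h'].
Qed.

Lemma box_generic_finall n (I : finType) (D : I -> 'rV[R]_n -> Prop) :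
  (forall i, box_generic (D i)) -> box_generic (fun x => forall i, D i x).
Proof.
move=> h; suff H (s : seq I) : box_generic (fun x => forall i, i \in s -> D i x).
  move=> a b /(H (enum I))[c [d [cd hx]]]; exists c, d; split => // x /hx hD i.
  by apply: hD; rewrite mem_enum.
elim: s => [|i s IH] a b ab.
  by have [c [d cd]] := nonempty_inbox ab; exists c, d.
have [c [d [cd hx]]] := box_generic_and (h i) IH ab; exists c, d; split => // x /hx[h1 h2] j.
by rewrite inE => /predU1P[->|/h2].
Qed.

End Regularity.

Section GenericRegularity.
Context {R : realType} {S : forall n : nat, set (set 'rV[R]_n)}.
Hypothesis hS : o_minimal_structure S.
Local Notation ddef := (@definable R S _ _).
Local Notation dfun := (@definable_fun R S _ _ _ _).

Lemma box_generic_of_dense n (D : 'rV[R]_n -> Prop) : ddef D ->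
  (forall a b, nonempty_box a b -> exists x, box a b x /\ D x) -> box_generic D.
Proof.
move=> dD h a b ab; have [c [d [cd [hD|nD]]]] := box_dichotomy hS dD ab.
  by exists c, d.
by have [x [hx /(nD x hx)]] := h _ _ (inbox_nonempty cd).
Qed.

(** A property that holds on some subbox cannot fail on the whole box, which leaves only the
    positive alternative. *)
Lemma box_generic_uniform n T (A : T * 'rV[R]_n -> Prop) u c d : nonempty_box c d ->
  box_generic (fun x => A (u, x)) -> uniform_on A u c d ->
  forall x, box c d x -> A (u, x).
Proof.
move=> cd hg [//|h]; have [e [f [ef hE]]] := hg _ _ cd.
have hc := box_midpoint (inbox_nonempty ef).
by case: (h _ (inbox_box ef hc)); apply: hE.
Qed.

Lemma definable_cont_at n T (dT : Dtype R T) (f : T * 'rV[R]_n -> R) : dfun f ->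
  ddef (fun p : T * 'rV[R]_n => cont_at (fun y => f (p.1, y)) p.2).
Proof. by move=> hf; rewrite /cont_at /box /nearby; definability. Qed.

Lemma definable_deriv_at n T (dT : Dtype R T) (f : T * 'rV[R]_n -> R) v : dfun f ->
  ddef (fun p : (T * 'rV[R]_n) * R =>
    deriv_at (fun h => f (p.1.1, h *: v + p.1.2)) 0 p.2).
Proof. by move=> hf; rewrite /deriv_at; definability. Qed.

Lemma definable_fun_derive n T (dT : Dtype R T) (f : T * 'rV[R]_n -> R) v : dfun f ->
  dfun (fun p : T * 'rV[R]_n => 'D_v (fun y => f (p.1, y)) p.2).
Proof.
move=> hf; pose D (p : (T * 'rV[R]_n) * R) :=
  deriv_at (fun h => f (p.1.1, h *: v + p.1.2)) 0 p.2.
have dD : ddef D by exact: definable_deriv_at.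
apply: (@definable_ext R S _ _ (fun p : (T * 'rV[R]_n) * R => D p \/
  (~ (exists s, D (p.1, s)) /\ p.2 = point))); last by clearbody D; definability.
move=> [[u x] s] /=.
have [[s' hs']|hno] := pselect (exists s, D ((u, x), s)).
  have hv := deriv_at_derive (f := fun y => f (u, y)) hs'; rewrite hv.
  split; last by move=> ->; left.
  move=> [h|[[]]]; last by exists s'.
  by rewrite -hv; apply/esym; apply: (deriv_at_derive (f := fun y => f (u, y)) h).
have -> := not_deriv_at_derive (f := fun y => f (u, y)) hno.
split; last by right.
by move=> [h|[_]//]; case: hno; exists s.
Qed.

Lemma definable_Ck_at n k T (dT : Dtype R T) (f : T * 'rV[R]_n -> R) : dfun f ->
  ddef (fun p : T * 'rV[R]_n => Ck_at k (fun y => f (p.1, y)) p.2).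
Proof.
elim: k f => [|k IH] f hf /=; (refine (definable_and hS _ _); first exact: definable_cont_at).
  by definability.
refine (definable_finall hS _) => i; refine (definable_and hS _ _).
  by refine (definable_ex hS _); exact: definable_deriv_at.
exact: (IH _ (definable_fun_derive (delta_mx ord0 i) hf)).
Qed.

(** Continuity holds wherever all comparisons of [f] with rational numbers are locally constant. *)
Lemma box_generic_cont n (f : 'rV[R]_n -> R) : dfun f -> box_generic (cont_at f).
Proof.
move=> hf; apply: box_generic_of_dense.
  by rewrite /cont_at /box /nearby; definability.
move=> a b ab.
pose E (k : rat + rat) x := match k with
  inl q => f x < ratr q | inr q => ratr q < f x end.
have dE k : ddef (E k) by case: k => q; rewrite /E; definability.
have [x [hx hE]] := generic_point_box hS dE ab; exists x; split=> // e e0.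
have [q1 [q11 q12]] := @rat_between R (f x - e) (f x) ltac:(lra).
have [q2 [q21 q22]] := @rat_between R (f x) (f x + e) ltac:(lra).
have [c1 [d1 [hx1 h1]]] := hE (inr q1); have [c2 [d2 [hx2 h2]]] := hE (inl q2).
exists (\row_i Num.max (c1 ord0 i) (c2 ord0 i)).
exists (\row_i Num.min (d1 ord0 i) (d2 ord0 i)); split.
  move=> i; rewrite !mxE gt_max lt_min.
  by have [-> ->] := hx1 i; have [-> ->] := hx2 i.
move=> y hy; have hy1 : box c1 d1 y.
  by move=> i; have := hy i; rewrite !mxE gt_max lt_min => -[/andP[? _] /andP[? _]].
have hy2 : box c2 d2 y.
  by move=> i; have := hy i; rewrite !mxE gt_max lt_min => -[/andP[_ ?] /andP[_ ?]].
have /= := proj2 (h1 y hy1) q12; have /= := proj2 (h2 y hy2) q21.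
by split; lra.
Qed.

(** The one-variable result, on the line through the centre parallel to the [i]-th axis, gives a
    suitable point in every box. *)
Lemma box_generic_deriv n (f : 'rV[R]_n -> R) i : dfun f ->
  box_generic (fun x => exists s, deriv_at (fun h => f (h *: delta_mx ord0 i + x)) 0 s).
Proof.
move=> hf; apply: box_generic_of_dense.
  by rewrite /deriv_at; definability.
move=> a b ab; pose c := midpoint a b; have hc := box_midpoint ab.
have [hc1 hc2] := hc i; rewrite -/c in hc1 hc2 hc; clearbody c.
have dg : dfun (fun h : R => f (h *: delta_mx ord0 i + c)) by definability.
have lt : a ord0 i - c ord0 i < b ord0 i - c ord0 i by lra.
have [h [h1 [h2 [s hs]]]] := derivative_exists hS dg lt.
exists (h *: delta_mx ord0 i + c); split.
  move=> j; rewrite !mxE eqxx /=; have := hc j.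
  by case: eqVneq => [->|_] /= [u1 u2]; rewrite ?mulr1n ?mulr0n; split; lra.
exists s => e e0; have [d [d0 hd]] := hs e e0; exists d; split => // y y1 y2.
by have := hd y y1 y2; rewrite add0r scale0r add0r scalerDl addrA (addrC (h *: _)).
Qed.

Lemma box_generic_Ck_at n k (f : 'rV[R]_n -> R) : dfun f -> box_generic (Ck_at k f).
Proof.
elim: k f => [|k IH] f hf /=; (apply: box_generic_and; first exact: box_generic_cont).
  by move=> a b ab; have [c [d cd]] := nonempty_inbox ab; exists c, d.
apply: box_generic_finall => i; apply: box_generic_and; first exact: box_generic_deriv.
apply: IH.
have hf' : dfun (fun p : unit * 'rV[R]_n => f p.2) by definability.
have h := definable_fun_derive (delta_mx ord0 i) hf'.
exact: (definable_fun_comp hS (f := fun x => (tt, x)) h ltac:(definability)).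
Qed.

End GenericRegularity.

(** * Good directions *)

Section BoxCells.
Context {R : realType} {S : forall n : nat, set (set 'rV[R]_n)}.
Hypothesis hS : o_minimal_structure S.
Local Notation ddef := (@definable R S _ _).
Local Notation dfun := (@definable_fun R S _ _ _ _).

Lemma box_is_cell n (a b : 'rV[R]_n) : nonempty_box a b -> is_cell S n (box a b).
Proof.
elim: n a b => [|n IH] a b.
  move=> _; have -> : box a b = setT by apply/predeqP => x; split => // _ [].
  exact: is_cell_point.
rewrite -(vpairK a) -(vpairK b).
move: (butlast a) (vlast a) (butlast b) (vlast b) => {a}a s {b}b t.
move=> /nonempty_box_vpair[ab st].
have dB : ddef (box a b) by rewrite /box; definability.
have hb r : cell_bound S (box a b) (fun=> r%:E).
  apply: Or33; exists (fun=> r) => //; split; last first.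
    by move=> x; exact: cvg_cst.
  by apply/definable_row; rewrite /graph_on /mkset /=; definability.
have -> : box (vpair a s) (vpair b t) = band_on (box a b) (fun=> s%:E) (fun=> t%:E).
  apply/predeqP => x; rewrite -{1}(vpairK x); split.
    by move=> /box_vpair[h1 [h2 h3]]; split => //; rewrite !lte_fin h2.
  by rewrite /band_on /= !lte_fin => -[h1 /andP[h2 h3]]; apply/box_vpair.
by apply: is_cell_band; [exact: IH|exact: hb|exact: hb|move=> x _; rewrite lte_fin].
Qed.

(** The form in which the dimension bound enters: a box is a cell of dimension [n + 1]. *)
Lemma dim_no_box n (X : set 'rV[R]_n.+1) :
  (omin_dim S X <= (n%:R)%:E)%E ->
  ~ exists a b, nonempty_box a b /\ forall x, box a b x -> X x.
Proof.
move=> hX [a [b [ab h]]].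
have : ((n.+1%:R)%:E <= omin_dim S X)%E.
  apply: ereal_sup_ubound; exists n.+1 => //.
  by exists (box a b); [exact: box_is_cell|].
by move=> /le_trans/(_ hX); rewrite lee_fin ler_nat ltnn.
Qed.

End BoxCells.

Lemma fin_root {R : realType} (p : {poly R}) : p != 0 -> fin (fun t => root p t).
Proof.
have [m] := ubnP (size p); elim: m p => // m IH p; rewrite ltnS => sp p0.
have [[r hr]|no] := pselect (exists r, root p r); last first.
  by exists [::] => t ht; case: no; exists t.
have /factor_theorem[q pq] := hr.
have q0 : q != 0 by apply: contra p0 => /eqP q0; rewrite pq q0 mul0r.
have [|//|s hs] := IH q.
  by move: sp; rewrite pq size_Mmonic ?monicXsubC// size_XsubC addnC.
exists (r :: s) => t; rewrite pq rootM inE root_XsubC => /orP[/hs ->|->] //.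
by rewrite orbT.
Qed.

(** * Contractions of a cube and the mean value inequality *)

Section FixedPoint.
Context {R : realType}.

HB.instance Definition _ (K : realType) m n := Complete.on 'M[K]_(m, n).

Lemma rV_norm_le n (x : 'rV[R]_n) (d : R) : 0 <= d ->
  (`|x| <= d) <-> (forall i, `|x ord0 i| <= d).
Proof.
move=> d0; rewrite [`|x|]/Num.norm /= mx_normrE; split.
  by move=> /bigmax_leP[_ h] i; exact: (h (ord0, i)).
by move=> h; apply/bigmax_leP; split => // -[i j] _ /=; rewrite (ord1 i).
Qed.

(** The cube is a closed ball of the sup norm, so Banach's theorem applies with ratio one half. *)
Lemma cube_fixed_point n (v0 : 'rV[R]_n) (r : R) (F : 'rV[R]_n -> 'rV[R]_n) :
  0 <= r ->
  (forall v, `|v - v0| <= r -> `|F v - v0| <= r) ->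
  (forall v w, `|v - v0| <= r -> `|w - v0| <= r ->
     `|F v - F w| <= 2^-1 * `|v - w|) ->
  exists2 v, `|v - v0| <= r & F v = v.
Proof.
move=> r0 hF hL; pose U := [set v : 'rV[R]_n | `|v - v0| <= r].
have hU : {homo F : x / U x >-> U x} by move=> x; exact: hF.
have h2 : (0 : R) <= 2^-1 by rewrite invr_ge0.
have [|||v Uv hv] := @banach_fixed_point R 'rV[R]_n U (mkfun_fun hU) _.
- exists (NngNum h2); split => /=; first by rewrite invf_lt1// ltr1n.
  by move=> [v w] [/= Uv Uw]; exact: hL.
- have -> : U = closed_ball_ Num.norm v0 r.
    by apply/predeqP => v; rewrite /U /closed_ball_ /= distrC.
  exact: closed_closed_ball_.
- by exists v0; rewrite /U /= subrr normr0.
by exists v.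
Qed.

Lemma deriv_at_is_derive (g : R -> R) x s : deriv_at g x s -> is_derive x 1 g s.
Proof.
move=> h; have h' : deriv_at (fun y => g (y *: (1 : R) + x)) 0 s.
  move=> e /h[d [d0 hd]]; exists d; split => // y y1 y2.
  rewrite add0r scale0r add0r (_ : y *: 1 = y) 1?(addrC y x); first exact: hd.
  exact: mulr1.
by split; [exact: deriv_at_derivable h'|exact: deriv_at_derive h'].
Qed.

Lemma mean_value_bound (g s : R -> R) (a b eta : R) : a <= b ->
  (forall x, a <= x -> x <= b -> deriv_at g x (s x) /\ `|s x| <= eta) ->
  `|g b - g a| <= eta * (b - a).
Proof.
move=> ab h.
have hd x : x \in `[a, b] -> is_derive x 1 g (s x).
  by rewrite in_itv /= => /andP[h1 h2]; apply: deriv_at_is_derive; have [] := h x h1 h2.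
have hc : {within `[a, b], continuous g}.
  by apply: derivable_within_continuous => x /hd[].
have ho x : x \in `]a, b[ -> is_derive x 1 g (s x).
  by move=> xab; apply: hd; exact: subset_itv_oo_cc xab.
have [c] := MVT_segment ab ho hc.
rewrite in_itv /= => /andP[h1 h2] ->; have [_ hs] := h c h1 h2.
rewrite normrM [`|b - a|]ger0_norm ?subr_ge0// ler_wpM2r ?subr_ge0//.
Qed.

End FixedPoint.

(** * A box in the image of a map with invertible derivative *)

Section OpenMapping.
Context {R : realType}.

Lemma box_radius n (c d x : 'rV[R]_n) : box c d x -> exists e, 0 < e /\
  forall y : 'rV[R]_n, (forall i, nearby (x ord0 i) e (y ord0 i)) -> box c d y.
Proof.
move=> /box_nbhs/nbhs_ballP[e /= e0 he]; exists e; split => // y hy.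
apply: he; split => // i j; rewrite (ord1 i); have [h1 h2] := hy j.
by rewrite /ball /= ltr_distlC; apply/andP.
Qed.

Lemma coord_le_norm n (x : 'rV[R]_n) i : `|x ord0 i| <= `|x|.
Proof. exact: (proj1 (rV_norm_le x (normr_ge0 x)) (lexx _)). Qed.

Lemma entry_le_norm m n (A : 'M[R]_(m, n)) i j : `|A i j| <= `|A|.
Proof.
rewrite [`|A|]/Num.norm /= mx_normrE.
exact: (le_bigmax _ (fun ij : 'I_m * 'I_n => `|A ij.1 ij.2|) (i, j)).
Qed.

Lemma mulmx_norm_le n (x : 'rV[R]_n) (N : 'M[R]_n) :
  `|x *m N| <= n%:R * `|N| * `|x|.
Proof.
apply/rV_norm_le => [|k]; first by rewrite !mulr_ge0.
rewrite mxE; apply: le_trans (ler_norm_sum _ _ _) _.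
apply: le_trans (_ : \sum_(j < n) `|N| * `|x| <= _).
  apply: ler_sum => j _; rewrite normrM mulrC.
  by apply: ler_pM => //; [exact: entry_le_norm|exact: coord_le_norm].
by rewrite sumr_const card_ord -[X in X <= _]mulr_natl mulrA.
Qed.

Lemma coordinate_lipschitz n (g : 'rV[R]_n -> R) (a b x : 'rV[R]_n) (eta : R) i (h : R) :
  (forall x, box a b x -> exists s,
     deriv_at (fun h => g (h *: delta_mx ord0 i + x)) 0 s /\ `|s| <= eta) ->
  box a b x -> box a b (h *: delta_mx ord0 i + x) ->
  `|g (h *: delta_mx ord0 i + x) - g x| <= eta * `|h|.
Proof.
move=> hd hx hhx; pose G y := g (y *: delta_mx ord0 i + x).
have G0 : g x = G 0 by rewrite /G scale0r add0r.
have hb y : Num.min 0 h <= y -> y <= Num.max 0 h ->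
    box a b (y *: delta_mx ord0 i + x).
  rewrite ge_min le_max => h1 h2 j; have := hx j; have := hhx j; rewrite !mxE eqxx /=.
  case: (j == i) => /=; rewrite ?mulr1n ?mulr0n => -[u1 u2] [u3 u4].
    by case/orP: h1 => h1; case/orP: h2 => h2; split; lra.
  by split; lra.
have /choice[s hs] : forall y, exists s, Num.min 0 h <= y -> y <= Num.max 0 h ->
    deriv_at G y s /\ `|s| <= eta.
  move=> y; have [[h1 h2]|no] := pselect (Num.min 0 h <= y /\ y <= Num.max 0 h).
    have [s [hs le]] := hd _ (hb y h1 h2); exists s => _ _; split => // e e0.
    have [d [d0 hd']] := hs e e0; exists d; split => // k k1 k2.
    have := hd' k k1 k2; rewrite add0r scale0r add0r /G scalerDl addrA.
    by rewrite (addrC (k *: _)).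
  by exists 0 => h1 h2; case: no.
rewrite G0 -/(G h); have [h0|h0] := leP 0 h.
  have := @mean_value_bound R G s 0 h eta h0; rewrite subr0 (ger0_norm h0); apply.
  by move=> y y1 y2; apply: hs; rewrite ?ge_min ?le_max ?y1 ?y2 ?orbT.
have := @mean_value_bound R G s h 0 eta (ltW h0).
rewrite sub0r (ltr0_norm h0) [`|G h - _|]distrC; apply.
by move=> y y1 y2; apply: hs; rewrite ?ge_min ?le_max ?y1 ?y2 ?orbT.
Qed.

(** The points [p k] lead from [v] to [w] by changing one coordinate at a time, without leaving the
    box. *)
Lemma box_lipschitz n (g : 'rV[R]_n -> R) (a b v w : 'rV[R]_n) (eta delta : R) :
  0 <= eta ->
  (forall x, box a b x -> forall i, exists s,
     deriv_at (fun h => g (h *: delta_mx ord0 i + x)) 0 s /\ `|s| <= eta) ->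
  box a b v -> box a b w -> (forall i, `|w ord0 i - v ord0 i| <= delta) ->
  `|g w - g v| <= n%:R * (eta * delta).
Proof.
move=> eta0 hd hv hw hvw.
pose p k : 'rV[R]_n := \row_i if (i < k)%N then w ord0 i else v ord0 i.
have hp k : box a b (p k) by move=> i; rewrite mxE; case: ifP.
have p0 : p 0%N = v by apply/rowP => i; rewrite mxE.
have pn : p n = w by apply/rowP => i; rewrite mxE ltn_ord.
have pS (i : 'I_n) : p i.+1 = (w ord0 i - v ord0 i) *: delta_mx ord0 i + p i.
  apply/rowP => j; rewrite !mxE eqxx /= ltnS.
  have [->|ne] := eqVneq j i; first by rewrite leqnn ltnn mulr1 subrK.
  rewrite mulr0 add0r leq_eqVlt.
  by rewrite (_ : (j == i :> nat) = false) //; apply/negbTE.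
rewrite -pn -[in g v]p0.
suff H k : (k <= n)%N -> `|g (p k) - g (p 0%N)| <= k%:R * (eta * delta).
  exact: H.
elim: k => [|k IH] kn; first by rewrite subrr normr0 mul0r.
rewrite -(subrK (g (p k)) (g (p k.+1))) -addrA.
apply: le_trans (ler_normD _ _) _.
rewrite -natr1 mulrDl mul1r; apply: le_trans (lerD (lexx _) (IH (ltnW kn))) _.
rewrite addrC; apply: lerD (lexx _) _.
have := pS (Ordinal kn); rewrite /= => E; rewrite E.
apply: le_trans (_ : eta * `|w ord0 (Ordinal kn) - v ord0 (Ordinal kn)| <= _).
  apply: (coordinate_lipschitz (a := a) (b := b)) => //.
    by move=> x hx; exact: hd.
  by rewrite -E.
by apply: ler_wpM2l.
Qed.

(* The derivative of [v |-> u v + t v] at [v0] is invertible, so Newton's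
   iteration for [u v + t v = y] with frozen derivative is a contraction of a
   small cube around [v0] as soon as [y] is close to its value at [v0]. *)
Lemma image_contains_box n (u : 'rV[R]_n -> 'rV[R]_n) (c d v0 : 'rV[R]_n) (t : R) :
  box c d v0 ->
  (forall x, box c d x -> forall j, Ck_at 1 (fun x => u x ord0 j) x) ->
  \matrix_(i, j) 'D_(delta_mx ord0 i) (fun x => u x ord0 j) v0 + t%:M \in unitmx ->
  exists a b, nonempty_box a b /\ forall y, box a b y ->
    exists v, box c d v /\ u v + t *: v = y.
Proof.
set A := \matrix_(i, j) _ => hv0 hu Munit.
set M := A + t%:M in Munit; pose N := invmx M.
(* Chosen so that [n * |N| * n * eta] is at most one half, the contraction ratio. *)
pose eta : R := (2 * (n%:R * `|N| * n%:R + 1))^-1.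
have C0 : 0 <= n%:R * `|N| * n%:R by rewrite !mulr_ge0.
have eta0 : 0 < eta by rewrite invr_gt0; lra.
have [e1 [e10 he1]] := box_radius hv0.
have [||e2 [e20 he2]] := @seq_common_radius R _ (enum {: 'I_n * 'I_n}) (fun ij e =>
    forall x : 'rV[R]_n, (forall k, nearby (v0 ord0 k) e (x ord0 k)) ->
      nearby (A ij.1 ij.2) eta ('D_(delta_mx ord0 ij.1) (fun x => u x ord0 ij.2) x)).
- move=> ij e e' h _ le x hx; apply: h => k; exact: nearby_sub (hx k).
- move=> [i j] _ /=; have [_ /(_ i)[_ [hc _]]] := hu v0 hv0 j.
  have [c' [d' [hx h]]] := hc eta eta0; have [e [e0 he]] := box_radius hx.
  by exists e; split => // x /he/h; rewrite mxE.
pose e := Num.min e1 e2; have e0 : 0 < e by rewrite lt_min e10.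
pose a := v0 - const_mx e; pose b := v0 + const_mx e.
have hab x : box a b x -> forall k, nearby (v0 ord0 k) e (x ord0 k).
  by move=> h k; have := h k; rewrite !mxE.
have habcd x : box a b x -> box c d x.
  by move=> /hab h; apply: he1 => k; apply: nearby_sub (h k); rewrite ge_min lexx.
(* The remainder after subtracting the derivative at [v0]; its partial derivatives are bounded by
   [eta] on the small box. *)
pose G j (v : 'rV[R]_n) := u v ord0 j - (v *m A) ord0 j.
have hG j x : box a b x -> forall i, exists s,
    deriv_at (fun h => G j (h *: delta_mx ord0 i + x)) 0 s /\ `|s| <= eta.
  move=> hx i; have [_ /(_ i)[[s hs] _]] := hu x (habcd x hx) j.
  exists (s - A i j); split.
    move=> e3 /hs[d3 [d30 hd3]]; exists d3; split => // h h1 h2.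
    have := hd3 h h1 h2; rewrite add0r scale0r add0r /G mulmxDl -scalemxAl.
    rewrite -rowE (_ : (h *: row i A + x *m A) ord0 j =
      h * A i j + (x *m A) ord0 j); last by rewrite !mxE.
    set a1 := u _ ord0 j; set a2 := u _ ord0 j; set a3 := (x *m A) ord0 j.
    have -> : a1 - (h * A i j + a3) - (a2 - a3) - (s - A i j) * h = a1 - a2 - s * h.
      by ring.
    by [].
  have [h1 h2] : nearby (A i j) eta ('D_(delta_mx ord0 i) (fun x => u x ord0 j) x).
    apply: (he2 (i, j)); first exact: mem_enum.
    by move=> k; apply: nearby_sub (hab _ hx k); rewrite ge_min lexx orbT.
  rewrite (deriv_at_derive (f := fun x => u x ord0 j) hs) in h1 h2.
  by rewrite ler_norml; apply/andP; split; lra.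
pose r := e / 2; have r0 : 0 < r by rewrite /r; lra.
have cube v : `|v - v0| <= r -> box a b v.
  move=> /rV_norm_le => /(_ (ltW r0)) h i; have := h i; rewrite !mxE ler_norml.
  by rewrite /r => /andP[h1 h2]; split; lra.
pose phi v := u v + t *: v.
(* With [y] this close to [phi v0], the first iteration step moves [v0] by at most [r / 2], so that
   [F] preserves the cube. *)
pose sigma := r / (2 * (n%:R * `|N| + 1)).
have C1 : 0 <= n%:R * `|N| by rewrite mulr_ge0.
have sigma0 : 0 < sigma by rewrite divr_gt0//; lra.
have v0r : `|v0 - v0| <= r by rewrite subrr normr0 ltW.
exists (phi v0 - const_mx sigma), (phi v0 + const_mx sigma); split.
  by move=> i; rewrite !mxE; lra.
move=> y hy.
have {}hy : `|phi v0 - y| <= sigma.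
  apply/rV_norm_le => [|i]; first exact: ltW.
  by have := hy i; rewrite !mxE ler_norml => -[h1 h2]; apply/andP; split; lra.
pose F v := v - (phi v - y) *m N.
have hF v w : `|v - v0| <= r -> `|w - v0| <= r -> `|F v - F w| <= 2^-1 * `|v - w|.
  move=> /cube hv /cube hw.
  pose D := \row_j (G j v - G j w).
  have -> : F v - F w = - (D *m N).
    have DE : D = phi v - phi w - (v - w) *m M.
      apply/rowP => j; rewrite /D mxE /G /phi /M mulmxDr mul_mx_scalar !mulmxBl.
      by rewrite !mxE; ring.
    have -> : F v - F w = (v - w) - (phi v - phi w) *m N.
      rewrite /F !mulmxBl; set p1 := phi v *m N; set p2 := phi w *m N.
      by apply/matrixP => ? ?; rewrite !mxE; ring.
    rewrite DE [in RHS]mulmxBl -(mulmxA (v - w)) mulmxV // mulmx1 opprB.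
    by [].
  rewrite normrN; apply: le_trans (mulmx_norm_le _ _) _.
  apply: le_trans (_ : n%:R * `|N| * (n%:R * (eta * `|v - w|)) <= _).
    apply: ler_wpM2l => //; apply/rV_norm_le; first by rewrite !mulr_ge0 // ltW.
    move=> j; rewrite mxE.
    apply: (@box_lipschitz n (G j) a b w v eta) => //; first exact: ltW.
      by move=> x hx; exact: hG.
    by move=> i; have := coord_le_norm (v - w) i; rewrite !mxE.
  rewrite !mulrA; apply: ler_wpM2r => //.
  by rewrite /eta invfM mulrCA ler_piMr ?invr_ge0// ler_pdivrMr ?mul1r; lra.
have [|v hv Fv] := @cube_fixed_point R n v0 r F (ltW r0) _ hF.
  move=> v hv; rewrite -(subrK (F v0) (F v)) -addrA.
  apply: le_trans (ler_normD _ _) _.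
  have h1 : `|F v - F v0| <= r / 2.
    apply: le_trans (hF _ _ hv v0r) _; rewrite mulrC ler_wpM2r//.
  have h2 : `|F v0 - v0| <= r / 2.
    rewrite /F addrAC subrr add0r normrN; apply: le_trans (mulmx_norm_le _ _) _.
    apply: le_trans (ler_wpM2l C1 hy) _.
    rewrite /sigma mulrA ler_pdivrMr; last by lra.
    set C := n%:R * `|N|.
    have -> : r / 2 * (2 * (C + 1)) = C * r + r by field.
    by lra.
  by lra.
exists v; split; first exact/habcd/cube.
have h : (phi v - y) *m N = 0.
  move: Fv => /eqP; rewrite /F subr_eq => /eqP E.
  by apply/esym/(@addrI _ v); rewrite addr0.
have : (phi v - y) *m N *m M = 0 by rewrite h mul0mx.
by rewrite -mulmxA mulVmx // mulmx1 => /eqP; rewrite subr_eq0 => /eqP.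
Qed.

(** The matrix is singular only if [- t] is an eigenvalue of [A], that is, a root of its
    characteristic polynomial. *)
Lemma fin_not_unitmx n (A : 'M[R]_n) : fin (fun t => A + t%:M \notin unitmx).
Proof.
have := fin_opp (fin_root (monic_neq0 (char_poly_monic A))).
apply: fin_sub => t; rewrite unitmxE unitfE negbK => /det0P[v v0 hv].
rewrite -eigenvalue_root_char; apply/eigenvalueP; exists v => //.
move: hv; rewrite mulmxDr mul_mx_scalar => /eqP; rewrite addr_eq0 => /eqP ->.
by rewrite scaleNr.
Qed.

End OpenMapping.

(** * Local definable choice and directions with finite fibres *)

Section Directions.
Context {R : realType} {S : forall n : nat, set (set 'rV[R]_n)}.
Hypothesis hS : o_minimal_structure S.
Local Notation ddef := (@definable R S _ _).
Local Notation dfun := (@definable_fun R S _ _ _ _).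

(** The partial function with graph [G] is extended by 0, which keeps it definable. *)
Lemma graph_fun T (dT : Dtype R T) (G : T * R -> Prop) : ddef G ->
  (forall t u u', G (t, u) -> G (t, u') -> u = u') ->
  exists f : T -> R, dfun f /\ forall t u, G (t, u) -> f t = u.
Proof.
move=> dG uG.
have /choice[f hf] : forall t, exists u, G (t, u) \/ (~ (exists u, G (t, u)) /\ u = 0).
  move=> t; have [[u hu]|no] := pselect (exists u, G (t, u)).
    by exists u; left.
  by exists 0; right.
exists f; split; last first.
  move=> t u hu; have [h|[[]]] := hf t; [exact: uG h hu|by exists u].
apply: (@definable_ext R S _ _ (fun p : T * R => G (p.1, p.2) \/
  (~ (exists u, G (p.1, u)) /\ p.2 = 0))); last by definability.
move=> [t u] /=; split=> [h|->]; last exact: hf.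
have := hf t; case: h => [h|[no ->]].
  by move=> [h'|[[]]]; [exact: uG h h'|exists u].
by move=> [h'|[_ ->]//]; case: no; exists (f t).
Qed.

Lemma fin_min (A : R -> Prop) : fin A -> (exists t, A t) ->
  exists t, A t /\ forall t', A t' -> t <= t'.
Proof.
move=> /fin_rk[N hN] [t At]; have {}hN := hN t; elim: N t At hN => [|N IH] t At hN.
  by case: hN.
have [[t' [lt At']]|no] := pselect (exists t', t' < t /\ A t').
  by apply: (IH t' At') => h; apply: hN; exists t'.
exists t; split => // t' At'; rewrite leNgt; apply/negP => lt.
by apply: no; exists t'.
Qed.

(* Either the fibres are infinite, hence contain rational points, one of which
   is common to all the fibres over a subbox, or they have a least element. *)
Lemma local_choice m (W : 'rV[R]_m * R -> Prop) (a b : 'rV[R]_m) : ddef W ->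
  nonempty_box a b -> (forall v, box a b v -> exists t, W (v, t)) ->
  exists c d, inbox a b c d /\ exists f : 'rV[R]_m -> R, dfun f /\
    forall v, box c d v -> W (v, f v).
Proof.
move=> dW ab hW.
pose E (k : option rat) v := match k with
  | Some q => W (v, ratr q)
  | None => exists t, W (v, t) /\ forall t', W (v, t') -> t <= t' end.
have dE k : ddef (E k) by case: k => [q|]; rewrite /E; definability.
have [v hv|[q|] [c [d [cd h]]]] := Baire_box hS dE ab.
- have dWv : ddef (fun t => W (v, t)) by definability.
  have [hf|/(infinite_itv hS dWv)[s [t [st hst]]]] := pselect (fin (fun t => W (v, t))).
    by exists None; apply: fin_min => //; exact: hW.
  by have [q [q1 q2]] := rat_between st; exists (Some q); exact: hst.
- exists c, d; split => //; exists (fun=> ratr q); split => //.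
  exact: definable_fun_cst.
- have [|t u u' [h1 h2] [h3 h4]|f [df hf]] := @graph_fun _ _ (fun p : 'rV[R]_m * R =>
      W (p.1, p.2) /\ forall t', W (p.1, t') -> p.2 <= t').
  + by definability.
  + by apply/eqP; rewrite eq_le; apply/andP; split; [apply: h2|apply: h4].
  + exists c, d; split => //; exists f; split => // v /h[t ht].
    by rewrite (hf v t ht); case: ht.
Qed.

(** The coordinates are chosen one after the other, shrinking the box each time. *)
Lemma local_choice_row m n (W : 'rV[R]_m * 'rV[R]_n -> Prop) (a b : 'rV[R]_m) :
  ddef W -> nonempty_box a b -> (forall v, box a b v -> exists t, W (v, t)) ->
  exists c d, inbox a b c d /\ exists f : 'rV[R]_m -> 'rV[R]_n, dfun f /\
    forall v, box c d v -> W (v, f v).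
Proof.
elim: n W a b => [|n IH] W a b dW ab hW.
  have [c [d cd]] := nonempty_inbox ab; exists c, d; split => //; exists (fun=> 0).
  split; first exact: definable_fun_cst.
  move=> v /(inbox_box cd)/hW[t]; by rewrite (thinmx0 t).
have [||c [d [cd [f [df hf]]]]] := IH (fun p : 'rV[R]_m * 'rV[R]_n =>
  exists t, W (p.1, vpair p.2 t)) a b _ ab.
- by definability.
- by move=> v /hW[x]; rewrite -(vpairK x) => hx; exists (butlast x), (vlast x).
have [||e [e' [ee [g [dg hg]]]]] := @local_choice m
    (fun p => W (p.1, vpair (f p.1) p.2)) c d _ (inbox_nonempty cd).
- by definability.
- by move=> v /hf.
exists e, e'; split; first exact: inbox_trans ee.
by exists (fun v => vpair (f v) (g v)); split => //; definability.
Qed.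

Variables (n : nat) (X : 'rV[R]_n.+1 -> Prop).
Hypothesis dX : ddef X.
Hypothesis nobox : ~ exists a b, nonempty_box a b /\ forall x, box a b x -> X x.

Lemma rat_subbox (a b : 'rV[R]_n) : nonempty_box a b -> exists q1 q2 : 'rV[rat]_n,
  inbox a b (map_mx ratr q1) (map_mx ratr q2).
Proof.
move=> ab.
have /choice[f hf] : forall i : 'I_n, exists p : rat * rat,
    a ord0 i < ratr p.1 /\ ratr p.1 < ratr p.2 :> R /\ ratr p.2 < b ord0 i.
  move=> i; have [q1 [h1 h2]] := rat_between (ab i).
  by have [q2 [h3 h4]] := rat_between h2; exists (q1, q2).
exists (\row_i (f i).1), (\row_i (f i).2) => i; rewrite !mxE; exact: hf.
Qed.

(** Otherwise an interval of slices would contain boxes, which may be taken rational. By [Baire1]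
    one of them lies in all slices over a subinterval, and [X] contains a box. *)
Lemma fin_fat_slices :
  fin (fun t => exists a b, nonempty_box a b /\ forall y, box a b y -> X (vpair y t)).
Proof.
apply: contrapT => /(infinite_itv hS)[|s [t [st h]]].
  by rewrite /nonempty_box /box; definability.
pose E (q : 'rV[rat]_n * 'rV[rat]_n) t :=
  nonempty_box (map_mx ratr q.1 : 'rV[R]_n) (map_mx ratr q.2) /\
  forall y, box (map_mx ratr q.1) (map_mx ratr q.2) y -> X (vpair y t).
have dE q : ddef (E q) by rewrite /E /box; definability.
have [y y1 y2|q [c [d [sc [cd [dt hE]]]]]] := Baire1 hS dE st.
  have [a [b [ab hab]]] := h y y1 y2; have [q1 [q2 hq]] := rat_subbox ab.
  exists (q1, q2); split; first exact: inbox_nonempty hq.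
  by move=> x hx; apply: hab; exact: inbox_box hx.
apply: nobox; exists (vpair (map_mx ratr q.1) c), (vpair (map_mx ratr q.2) d).
have [pq _] := hE ((c + d) / 2) ltac:(lra) ltac:(lra).
split; first by apply/nonempty_box_vpair.
move=> x; rewrite -(vpairK x) => /box_vpair[h1 [h2 h3]].
by have [_] := hE _ h2 h3; apply.
Qed.

Lemma good_directions :
  box_generic (fun v : 'rV[R]_n => forall u, fin (fun t => X (vpair (u + t *: v) t))).
Proof.
(* Lines of direction [(v, 1)] are parametrized by height, and [u] is the point at height 0. By
   o-minimality an infinite fibre contains an interval. *)
pose bad (v : 'rV[R]_n) := exists u, exists s, exists t, s < t /\
  forall r, s < r -> r < t -> X (vpair (u + r *: v) r).
have H : box_generic (fun v => ~ bad v).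
  apply: (box_generic_of_dense hS); first by rewrite /bad; definability.
  move=> a b ab; apply: contrapT => hno.
  pose E (q : rat * rat) v := ratr q.1 < ratr q.2 :> R /\ exists u, forall r,
    ratr q.1 < r -> r < ratr q.2 -> X (vpair (u + r *: v) r).
  have dE q : ddef (E q) by rewrite /E; definability.
  have [v hv|[q1 q2] [c [d [cd hE]]]] := Baire_box hS dE ab.
    have [u [s [t [st h]]]] : bad v.
      by apply: contrapT => nb; apply: hno; exists v.
    have [q1 [h1 h2]] := rat_between st; have [q2 [h3 h4]] := rat_between h2.
    by exists (q1, q2); split => //; exists u => r r1 r2; apply: h => /=; lra.
  have [q12 _] := hE _ (box_midpoint (inbox_nonempty cd)); rewrite /= in q12.
  have [|v hv|c1 [d1 [cd1 [f [df hf]]]]] := @local_choice_row n n (fun p =>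
    forall r, ratr q1 < r -> r < ratr q2 -> X (vpair (p.2 + r *: p.1) r))
    c d _ (inbox_nonempty cd).
  - by definability.
  - by have [_] := hE v hv.
  have hg : box_generic (fun v => forall j, Ck_at 1 (fun x => f x ord0 j) v).
    by apply: box_generic_finall => j; apply: (box_generic_Ck_at hS); definability.
  have [c2 [d2 [cd2 hgood]]] := hg _ _ (inbox_nonempty cd1).
  have hv0 := box_midpoint (inbox_nonempty cd2).
  pose A : 'M[R]_n := \matrix_(i, j) 'D_(delta_mx ord0 i) (fun x => f x ord0 j)
    (midpoint c2 d2).
  (* At such a height [v |-> f v + t v] has invertible derivative at the centre, so its image,
     contained in the slice of [X], contains a box, although the slice was chosen to contain
     none. *)
  have [t [t1 [t2 nt]]] :=
    fin_not_itv (fin_or fin_fat_slices (fin_not_unitmx A)) q12.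
  have At : A + t%:M \in unitmx.
    by apply: contrapT => /negP nu; apply: nt; right.
  apply: nt; left.
  have [e1 [e2 [pe he]]] := image_contains_box hv0 hgood At.
  exists e1, e2; split => // y /he[v [hv <-]].
  by apply: (hf v) => //; exact: inbox_box hv.
move=> a b /H[c [d [cd h]]]; exists c, d; split => // v /h nb u.
apply: contrapT => /(infinite_itv hS)[|s [t [st hst]]]; first by definability.
by apply: nb; exists u, s, t.
Qed.

End Directions.

(** * The theorem *)

Lemma eball_coord (R : realType) n (v w : 'rV[R]_n) (r : R) i :
  eball v r w -> nearby (v ord0 i) r (w ord0 i).
Proof.
rewrite /eball /= => h.
have : `|w ord0 i - v ord0 i| < r.
  apply: le_lt_trans h; rewrite -sqrtr_sqr; apply: ler_wsqrtr.
  by rewrite (bigD1 i) //= lerDl sumr_ge0 // => j _; rewrite sqr_ge0.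
by rewrite ltr_distl => /andP[h1 h2]; split.
Qed.

Lemma nth_elem_index (R : realType) (A : R -> Prop) j k t :
  nth_elem A j t -> nth_elem A k t -> j = k.
Proof.
move=> [_ [h1 h2]] [_ [h3 h4]]; case: (ltngtP j k) => // jk; exfalso.
  exact/h2/(rk_leq jk).
exact/h4/(rk_leq jk).
Qed.

(** Converts the parameter [t] measured from [x] into the height [vlast x + t] used for
    [good_directions]. *)
Lemma line_vpair (R : realType) n (x : 'rV[R]_n.+1) (v : 'rV[R]_n) t :
  x + t *: vpair v 1 =
  vpair (butlast x - vlast x *: v + (vlast x + t) *: v) (vlast x + t).
Proof.
rewrite -[in LHS](vpairK x); apply/rowP => j; case: (unliftP ord_max j) => [i|] ->.
  by rewrite [LHS]mxE [X in _ + X]mxE !vpair_lift !mxE; ring.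
by rewrite [LHS]mxE [X in _ + X]mxE !vpair_max mulr1.
Qed.

Theorem theorem2p3 (R : realType) (S : forall n : nat, set (set 'rV[R]_n))
    (hS : o_minimal_structure S) (n : nat) (X : set 'rV[R]_n.+1)
    (hX : S n.+1 X) (hdim : (omin_dim S X <= (n%:R)%:E)%E)
    (p : nat) (hp : (0 < p)%N) :
  exists (eps : R) (V : seq 'rV[R]_n),
    0 < eps /\
    forall x : 'rV[R]_n.+1,
      exists2 v : 'rV[R]_n, v \in V & weak_regular eps p v x X.
Proof.
have dX : @definable R S _ _ (X : 'rV[R]_n.+1 -> Prop) := proj1 (definable_row X) hX.
have nobox := dim_no_box hS hdim.
have [|a [b [ab hdir]]] := good_directions hS dX nobox (a := const_mx (-1)) (b := const_mx 1).
  by move=> i; rewrite !mxE; lra.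
have {}ab := inbox_nonempty ab.
(* Restricting [v] to the box of good directions makes every fibre finite, as uniform finiteness
   demands. *)
pose Y (q : ('rV[R]_n.+1 * 'rV[R]_n) * R) :=
  box a b q.1.2 /\ q.2 != 0 /\ X (q.1.1 + q.2 *: vpair q.1.2 1).
have dY : @definable R S _ _ Y by rewrite /Y /box; definability.
have fY u : fin (fun t => Y (u, t)).
  have [hb|nb] := pselect (box a b u.2); last by exists [::] => t [].
  have [s hs] := hdir _ hb (butlast u.1 - vlast u.1 *: u.2).
  exists [seq r - vlast u.1 | r <- s] => t [_ [_ /= hXt]].
  apply/mapP; exists (vlast u.1 + t); last by rewrite addrC addKr.
  by apply: hs; rewrite -line_vpair.
have [N hN] := uniform_finiteness hS dY fY.
have /choice[f hf] : forall j, exists g : 'rV[R]_n.+1 * 'rV[R]_n -> R,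
    @definable_fun R S _ _ _ _ g /\ forall u t, nth_elem (fun t => Y (u, t)) j t -> g u = t.
  move=> j; apply: (graph_fun hS
    (G := fun q : ('rV[R]_n.+1 * 'rV[R]_n) * R => nth_elem (fun t => Y (q.1, t)) j q.2)).
    apply: (definable_nth_elem hS (P := fun (q : ('rV[R]_n.+1 * 'rV[R]_n) * R) t => Y (q.1, t))).
      by clearbody Y; definability.
    exact: definable_fun_proj2.
  by move=> u t t' /=; exact: nth_elem_inj.
pose K j (q : 'rV[R]_n.+1 * 'rV[R]_n) := exists t, nth_elem (fun t => Y (q, t)) j t.
have dK j : @definable R S _ _ (K j).
  refine (definable_ex hS _).
  apply: (definable_nth_elem hS (P := fun (q : ('rV[R]_n.+1 * 'rV[R]_n) * R) t => Y (q.1, t))).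
    by clearbody Y; definability.
  exact: definable_fun_proj2.
(* For each index two families parametrized by [x]: where the [j]-th point exists, and where its
   function is C^p in the direction. *)
pose A (k : nat * bool) (q : 'rV[R]_n.+1 * 'rV[R]_n) : Prop :=
  if k.2 then K k.1 q else Ck_at p (fun y => f k.1 (q.1, y)) q.2.
have dA k : @definable R S _ _ (A k).
  by case: k => j []; [exact: dK|exact: (definable_Ck_at hS p (hf j).1)].
have [l [hl hu]] := uniform_family hS
  [seq (j, k) | j <- iota 0 N, k <- [:: true; false]] dA ab.
have [||eps [eps0 heps]] := @seq_common_radius R _ l
    (fun Q e => forall w, eball (midpoint Q.1 Q.2) e w -> box Q.1 Q.2 w).
- move=> Q e e' h _ le w hw; apply: h; exact: lt_le_trans hw le.
- move=> Q hQ.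
  have [e [e0 he]] := box_radius (box_midpoint (inbox_nonempty (hl Q hQ))).
  by exists e; split => // w hw; apply: he => i; exact: eball_coord.
(* The directions are the centres of the boxes, and [eps] is a common radius of Euclidean balls
   inside them; neither depends on [x]. *)
exists eps, [seq midpoint Q.1 Q.2 | Q <- l]; split => // x.
have [Q hQ hQA] := hu x; exists (midpoint Q.1 Q.2); first exact: map_f.
have hQ' := hl Q hQ; have pQ := inbox_nonempty hQ'.
have hc := box_midpoint pQ; set v := midpoint Q.1 Q.2 in hc *.
have hb w : eball v eps w -> box Q.1 Q.2 w by exact: heps.
have hab w : box Q.1 Q.2 w -> box a b w by exact: inbox_box.
split.
  move=> u; have [s hs] := hdir v (hab _ hc) u.
  apply: (@sub_finite_set _ _ ((fun t => vpair (u + t *: v) t) @` [set` s])).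
    move=> y [Xy /= hy]; exists (vlast y); last first.
      by rewrite -hy subrK vpairK.
    by apply: hs; rewrite -hy subrK vpairK.
  exact/finite_image/finite_seq.
have hKj j w : (j < N)%N -> box Q.1 Q.2 w -> (K j (x, w) <-> K j (x, v)).
  move=> jN hw; have [|h|h] := hQA (j, true).
  - by apply: allpairs_f; rewrite ?mem_iota.
  - by split => _; exact: h.
  - by split=> [/(h w hw)|/(h v hc)].
have hgood j w : (j < N)%N -> box Q.1 Q.2 w -> Ck_at p (fun y => f j (x, y)) w.
  move=> jN; apply: (box_generic_uniform (A := A (j, false)) pQ).
    have dfj := (hf j).1.
    have dg : @definable_fun R S _ _ _ _ (fun y => f j (x, y)) by definability.
    exact: (box_generic_Ck_at hS p dg).
  by apply: hQA; apply: allpairs_f; rewrite ?mem_iota.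
(* The [j]-th point exists over all of [Q] or nowhere on it, so the centre decides which sheets are
   present. *)
pose js := [seq j <- iota 0 N | `[< K j (x, v) >]].
have hjs j : (j \in js) <-> (j < N)%N /\ K j (x, v).
  rewrite mem_filter mem_iota add0n leq0n /=.
  by split=> [/andP[/asboolP ? ?]|[? ?]] //; apply/andP; split => //; apply/asboolP.
have hnth (i : 'I_(size js)) : (nth 0 js i < N)%N /\ K (nth 0%N js i) (x, v).
  by apply/hjs/mem_nth.
have hval (i : 'I_(size js)) w : eball v eps w ->
    nth_elem (fun t => Y ((x, w), t)) (nth 0%N js i) (f (nth 0%N js i) (x, w)).
  move=> /hb hw; have [jN Kj] := hnth i.
  have [t ht] := proj2 (hKj _ _ jN hw) Kj.
  by rewrite ((hf _).2 _ _ ht).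
(* An empty intersection is covered by this case, with no sheets. *)
right; exists (size js), (fun i w => f (nth 0%N js i) (x, w)); split.
- by move=> i; apply: Ck_at_is_Cp => w /hb; apply: hgood; case: (hnth i).
- by move=> i w /(hval i)[[_ [h _]] _].
(* A common point of two sheets has the same height, hence the same nonzero parameter, hence the
   same direction; its rank in the fibre then determines the index. *)
- move=> i i' _ _ [y [[w hw <-] [w' hw' /esym E]]].
  have [[_ [t0 _]] _] := hval i w hw.
  have := E; rewrite !line_vpair => E'.
  have tt : f (nth 0%N js i) (x, w) = f (nth 0%N js i') (x, w').
    by have := congr1 (@vlast R n) E'; rewrite !vlast_vpair => /addrI.
  have ww : w = w'.
    have /(congr1 (@butlast R n)) := @addrI _ x _ _ E.
    rewrite -tt => E2; apply: (scalerI t0).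
    by apply/rowP => k; have := congr1 (fun m : 'rV[R]_n => m ord0 k) E2;
       rewrite !mxE !liftK.
  apply/val_inj/eqP; rewrite -(nth_uniq 0%N (ltn_ord i) (ltn_ord i')); last first.
    by rewrite filter_uniq ?iota_uniq.
  have h1 := hval i w hw; have h2 := hval i' w' hw'.
  rewrite -tt -ww in h2.
  by apply/eqP; exact: nth_elem_index h1 h2.
apply/predeqP => y; split.
  move=> [Xy [t /= t0 [w hw hy]]].
  have Yt : Y ((x, w), t) by split; [exact/hab/hb|split => //=; rewrite hy].
  have [j [jN hj]] : exists j, (j < N)%N /\ nth_elem (fun t => Y ((x, w), t)) j t.
    by apply: nth_elem_ex => // r; apply: (hN (x, w)); exists t.
  have hjj : j \in js by apply/hjs; split => //; apply/(hKj j w jN (hb w hw)); exists t.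
  have hi : (index j js < size js)%N by rewrite index_mem.
  exists (Ordinal hi) => //; exists w => //=.
  by rewrite nth_index // ((hf j).2 _ _ hj).
move=> [i _ [w hw <-]]; have [[_ [t0 Xt]] _] := hval i w hw.
by split => //; exists (f (nth 0%N js i) (x, w)) => //; exists w.
Qed.
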